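(* Let $\omega$ be an atomless probability law on $\mathbb{R}$ that is not entirely singular with respect to Lebesgue measure in the neighbourhood of $\sup(\mathrm{supp}(\omega))$, i.e. for every neighbourhood $U$ of $\sup(\mathrm{supp}(\omega))\in(-\infty,+\infty]$ the restriction of $\omega$ to $U$ is not singular with respect to Lebesgue measure. Let $\hat\pi$ be a law on the natural integers $\{0,1,2,\dots\}$ with finite expectation. Then there is a unique probability law $\zeta$ satisfying $$Z\overset{\text{(law)}}{=}\max\Big(0,\max_{1\le i\le N}(w_i-Z_i)\Big),$$ where $N\sim\hat\pi$, $w_i\sim\omega$ and $Z_i,Z\sim\zeta$, and $N$, the $w_i$'s and the $Z_i$'s are all independent.
   Context: When $N=0$ the right-hand side of the distributional equation is $0$. $\mathrm{supp}(\omega)$ denotes the topological support of $\omega$. *)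

(* Defs.v *)
From HB Require Import structures.
From mathcomp Require Import all_boot all_order all_algebra finmap.
From mathcomp Require Import all_classical all_reals all_analysis.

Set Implicit Arguments.
Unset Strict Implicit.
Unset Printing Implicit Defensive.

Import Order.TTheory GRing.Theory Num.Theory.
Import numFieldNormedType.Exports.

Local Open Scope classical_set_scope.
Local Open Scope ring_scope.
Local Open Scope ereal_scope.

Definition atomless (R : realType) (mu : probability (measurableTypeR R) R) :=
  forall x : R, mu [set x] = 0.

(* Only open neighbourhoods are tested: a measure is a total function on sets,
   with no meaning outside the measurable ones. *)
Definition msupport (R : realType) (mu : probability (measurableTypeR R) R) :
    set R :=
  [set x | forall U : set R, open_nbhs x U -> 0 < mu U].

Definition sup_msupport (R : realType)
    (mu : probability (measurableTypeR R) R) : \bar R :=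
  ereal_sup (EFin @` msupport mu).

Definition mutually_singular d (T : measurableType d) (R : realType)
    (mu nu : {measure set T -> \bar R}) :=
  exists A : set T, [/\ measurable A, mu A = 0 & nu (~` A) = 0].

(* The neighbourhoods are those of a point of the extended real line, so that
   the supremum may be +oo;
   [EFin @^-1` U] is the trace of U on the real line. *)
Definition not_singular_near_sup (R : realType)
    (mu : probability (measurableTypeR R) R) :=
  forall U : set (\bar R), nbhs (sup_msupport mu) U ->
  forall mU : measurable (EFin @^-1` U : set (measurableTypeR R)),
  ~ mutually_singular (mrestr mu mU) (@lebesgue_measure R).

(* Measures are only meaningful on measurable sets, hence so is their
   equality. *)
Definition same_law d (T : measurableType d) (R : realType)
    (mu nu : set T -> \bar R) :=
  forall A : set T, measurable A -> mu A = nu A.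

Definition mutually_independent d (Omega : measurableType d) (R : realType)
    (P : probability Omega R) (I : choiceType) (F : I -> set_system Omega) :=
  forall (J : {fset I}) (A : I -> set Omega),
    (forall j, j \in J -> F j (A j)) ->
    P (\bigcap_(j in [set` J]) A j) = \prod_(j <- J) P (A j).

Definition sigma_of d (Omega : measurableType d) d' (T : measurableType d')
    (X : Omega -> T) : set_system Omega :=
  preimage_set_system [set: Omega] X measurable.

(* N, the w_i's and the Z_i's form a single family, handled through the
   generated sigma-algebras because the codomains differ. *)
Definition joint_sigma d (Omega : measurableType d) (R : realType)
    (N : Omega -> nat) (w Z : nat -> Omega -> measurableTypeR R)
    (k : unit + (nat + nat)) : set_system Omega :=
  match k with
  | inl _ => sigma_of N
  | inr (inl i) => sigma_of (w i)
  | inr (inr i) => sigma_of (Z i)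
  end.

(* The indices 1 <= i <= N are shifted to i < N. The outer maximum with 0 is
   the neutral element of the iterated maximum, whose value is thus 0 when
   N = 0. *)
Definition rde_rhs (R : realType) (Omega : Type)
    (N : Omega -> nat) (w Z : nat -> Omega -> R) (x : Omega) : R :=
  (\big[Num.max/0]_(i < N x) (w i x - Z i x))%R.

Definition rde_solution (R : realType)
    (omega : probability (measurableTypeR R) R) (pihat : probability nat R)
    (zeta : probability (measurableTypeR R) R) :=
  exists (d : measure_display) (Omega : measurableType d)
    (P : probability Omega R) (N : {RV P >-> nat})
    (w Z : nat -> {RV P >-> measurableTypeR R}),
    [/\ same_law (distribution P N) pihat,
        forall i, same_law (distribution P (w i)) omega,
        forall i, same_law (distribution P (Z i)) zeta,
        mutually_independent P (joint_sigma N w Z)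
      & same_law zeta
          (pushforward P (rde_rhs N w Z : Omega -> measurableTypeR R))].

(* Main.v *)
Require Import Defs.
From HB Require Import structures.
From mathcomp Require Import all_boot all_order all_algebra finmap.
From mathcomp Require Import all_classical all_reals all_analysis.
From mathcomp Require Import measurable_realfun ring lra.

(** On distribution functions the right-hand side acts through the map [next_cdf],
    F |-> 1_{t >= 0} G(P(w - Z <= t)) where G is the generating function of N,
    which is antitone. Iterated from the law at 0, its even and odd iterates
    converge to a pair F_beta <= F_alpha, exchanged by the map, that encloses every
    solution. With X = w - Z_alpha, the number P(w >= Z_alpha + Z_beta) is symmetric
    in alpha and beta and equals the integral of G over ]F_X(0), 1[; since G > 0
    there, P(w - Z_alpha <= t) and P(w - Z_beta <= t) agree at t = 0. The set E of
    the t at which they agree is closed under suprema and, when t is in E, it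
    contains w - t for omega-almost every w >= t. Taking two such steps with
    neighbouring points w1 < w2 moves a point of E slightly to the right, so E
    cannot stop before omega ]t, +oo[ vanishes: alpha and beta coincide. *)

Set Implicit Arguments.
Unset Strict Implicit.
Unset Printing Implicit Defensive.

Import Order.TTheory GRing.Theory Num.Theory.
Import numFieldNormedType.Exports.

Local Open Scope classical_set_scope.
Local Open Scope ring_scope.
Local Open Scope ereal_scope.

(** The iterates of an antitone map may settle on a cycle of length two, and the whole difficulty is
    to exclude one. Because F_alpha - F_beta has a constant sign, equality of two integrals of these
    functions forces them to agree almost everywhere. The agreement then passes through G, which is
    strictly increasing unless N = 0 almost surely, a case settled apart. A single step t -> w - t
    reverses the order and may land far away; two of them compose to the translation by w2 - w1,
    which is small and positive. Absence of atoms passes from w to w - Z. It makes F_X(X) uniform,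
    identifies P(w - Z >= t) with the complement of P(w - Z <= t), and gives the left continuity
    that closes E under suprema. Since a solution is a law carried by some family of independent
    variables, the reduction to distribution functions also requires such a family for every law; it
    is built from the binary digits of a uniform number. *)

Lemma pushforward_law d d' (T : measurableType d) (T' : measurableType d')
    (R : realType) (P : probability T R) (X : T -> T') :
  measurable_fun setT X ->
  exists nu : probability T' R, forall A, nu A = P (X @^-1` A).
Proof.
move=> mX.
pose X' : {mfun T >-> T'} := HB.pack X (@isMeasurableFun.Build _ _ _ _ X mX).
by exists (distribution P X').
Qed.

Lemma exists_pushforward d d' (T : measurableType d) (T' : measurableType d')
    (R : realType) (mu : {measure set T -> \bar R}) (X : T -> T') :
  measurable_fun setT X ->
  exists nu : {measure set T' -> \bar R}, forall A, nu A = mu (X @^-1` A).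
Proof.
by move=> mX; unshelve eexists; [refine (pushforward mu X : {measure set T' -> \bar R})|].
Qed.

Lemma exists_RV d d' (T : measurableType d) (T' : measurableType d')
    (R : realType) (P : probability T R) (X : T -> T') :
  measurable_fun setT X -> exists X' : {RV P >-> T'}, X' = X :> (T -> T').
Proof.
move=> mX.
by exists (HB.pack_for {mfun T >-> T'} X (@isMeasurableFun.Build _ _ _ _ X mX)).
Qed.

(** * Distribution functions and quantiles *)

Section Rays.
Variable R : realType.
Implicit Types (mu nu : probability (measurableTypeR R) R) (t : R).

Definition cdfR mu t : R := fine (mu `]-oo, t]%classic).

Lemma cdfRE mu t : (cdfR mu t)%:E = mu `]-oo, t]%classic.
Proof. by rewrite fineK// fin_num_measure. Qed.

Lemma cdfR_ge0 mu t : (0 <= cdfR mu t)%R.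
Proof. by rewrite -lee_fin cdfRE. Qed.

Lemma cdfR_le1 mu t : (cdfR mu t <= 1)%R.
Proof. by rewrite -lee_fin cdfRE probability_le1. Qed.

Lemma cdfR_nd mu : {homo cdfR mu : s t / (s <= t)%R}.
Proof.
move=> s t st; rewrite -lee_fin !cdfRE le_measure ?inE//.
by apply: subset_itvl; rewrite bnd_simp.
Qed.

Lemma cdfR_measurable mu :
  measurable_fun setT (cdfR mu : measurableTypeR R -> measurableTypeR R).
Proof. exact: nondecreasing_measurable (@cdfR_nd mu). Qed.

Lemma cdfR_ccdf mu t : mu `]t, +oo[%classic = (1 - cdfR mu t)%:E.
Proof.
rewrite EFinB cdfRE -probability_setC//.
by rewrite setCitvl.
Qed.

(** The open rays to the right form a generating pi-system that exhausts the line, and finite mass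
    turns agreement on their complements into agreement on them. Measures of any finite mass are
    allowed because the law of [dbl] is studied on each half of the unit interval separately. *)
Lemma eq_measure_rays (mu nu : {measure set (measurableTypeR R) -> \bar R}) :
  (mu setT < +oo) -> mu setT = nu setT ->
  (forall t, mu `]-oo, t]%classic = nu `]-oo, t]%classic) ->
  forall A, measurable A -> mu A = nu A.
Proof.
move=> muoo mnT h A mA.
have muray t : mu `]-oo, t]%classic \is a fin_num.
  rewrite ge0_fin_numE//; apply: le_lt_trans muoo.
  by apply: le_measure; rewrite ?inE//; exact: measurableT.
pose G := [set A : set R | exists x : R, A = `]x, +oo[%classic].
apply: (@measure_unique _ R (measurableTypeR R) G
         (fun n => `](- n%:R)%R, +oo[%classic)) => //.
- exact: RGenOInfty.measurableE.
- move=> _ _ [x ->] [y ->]; exists (Num.max x y).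
  by apply/seteqP; split=> z /=; rewrite !in_itv/= !andbT gt_max => /andP.
- by move=> i; exists (- i%:R)%R.
- rewrite -subTset => x _; exists (Num.bound `|x|%R) => //=.
  rewrite in_itv/= andbT ltrNl (le_lt_trans (ler_norm _))// normrN.
  exact: archi_boundP (normr_ge0 _).
- have rayC (m : {measure set (measurableTypeR R) -> \bar R}) x :
      m setT = m `]-oo, x]%classic + m `]x, +oo[%classic.
    rewrite -measureU//.
      by rewrite -setCitvl setUv.
    by rewrite -setCitvl setICr.
  move=> _ [x ->].
  have := mnT; rewrite !(rayC _ x) h => /(congr1 (fun y => y - nu `]-oo, x]%classic)).
  by rewrite -h addeAC subee// add0e addeAC h subee ?add0e// -h.
- move=> k; apply: le_lt_trans muoo.
  by apply: le_measure; rewrite ?inE//; exact: measurableT.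
Qed.

Lemma eq_cdfR mu nu : cdfR mu =1 cdfR nu ->
  forall A, measurable A -> mu A = nu A.
Proof.
move=> h; apply: eq_measure_rays => [||t].
- by apply: le_lt_trans (ltry 1%R); rewrite probability_le1.
- exact: eq_trans (probability_setT mu) (esym (probability_setT nu)).
- by apply: eq_trans (esym (cdfRE mu t)) _; rewrite h cdfRE.
Qed.

End Rays.

Section Quantile.
Variable R : realType.
Implicit Types (t u : R).

Definition unif : probability (measurableTypeR R) R := uniform_prob (@ltr01 R).

Lemma unifE (A : set R) : measurable A ->
  unif A = @lebesgue_measure R (A `&` `[0%R, 1%R]%classic).
Proof.
move=> mA; rewrite /unif/= /uniform_prob integral_uniform_pdf.
rewrite (eq_integral (cst 1%:E)); last first.
  by move=> x; rewrite inE/= in_itv/= /uniform_pdf => -[_ ->]; rewrite subr0 invr1.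
by rewrite integral_cst ?mul1e//; exact: measurableI.
Qed.

Lemma unif_ray t : (0 <= t <= 1)%R -> unif `]-oo, t]%classic = t%:E.
Proof.
move=> /andP[t0 t1]; rewrite unifE//.
have -> : `]-oo, t]%classic `&` `[0%R, 1%R]%classic = `[0%R, t]%classic :> set R.
  apply/seteqP; split=> x/=; rewrite !in_itv/=.
    by move=> [-> /andP[->]].
  by move=> /andP[-> xt]; rewrite xt (le_trans xt).
rewrite lebesgue_measure_itv/= lte_fin.
case: ltP => [_|h]; first by rewrite -EFinB subr0.
by congr EFin; apply/eqP; rewrite eq_le t0 h.
Qed.

Lemma unif_oo : unif `]0%R, 1%R[%classic = 1.
Proof.
rewrite unifE//.
have -> : `]0%R, 1%R[%classic `&` `[0%R, 1%R]%classic = `]0%R, 1%R[%classic :> set R.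
  apply/seteqP; split=> x/=; rewrite !in_itv/=; first by case.
  by move=> /[dup] ? /andP[/ltW -> /ltW ->].
by rewrite lebesgue_measure_itv/= lte_fin ltr01 -EFinB subr0.
Qed.

Lemma prob1_setI d (T : measurableType d) (P : probability T R) (A B : set T) :
  measurable A -> measurable B -> P B = 1 -> P (A `&` B) = P A.
Proof.
move=> mA mB PB.
apply/eqP; rewrite eq_le; apply/andP; split.
  by apply: le_measure; rewrite ?inE//; exact: measurableI.
have -> : P A = P ((A `&` B) `|` (A `&` ~` B)).
  by rewrite -setIUr setUv setIT.
rewrite measureU//; last 3 first.
- exact: measurableI.
- by apply: measurableI => //; exact: measurableC.
- by rewrite setIACA setICr setI0.
rewrite [X in _ + X](_ : _ = 0) ?adde0//.
apply/eqP; rewrite -measure_le0.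
have <- : P (~` B) = 0 by rewrite probability_setC// PB subee.
apply: le_measure; rewrite ?inE//.
  by apply: measurableI => //; exact: measurableC.
exact: measurableC.
Qed.

(* The second hypothesis is right continuity, in a form that a decreasing limit
   of distribution functions satisfies at once. *)
Lemma exists_quantile (F : R -> R) :
  {homo F : s t / (s <= t)%R} ->
  (forall t u, (forall s, (t < s)%R -> (u <= F s)%R) -> (u <= F t)%R) ->
  (forall u, (0 < u)%R -> exists t, (F t < u)%R) ->
  (forall u, (u < 1)%R -> exists t, (u <= F t)%R) ->
  exists Q : measurableTypeR R -> measurableTypeR R, [/\ measurable_fun setT Q &
    forall u t, (0 < u < 1)%R -> (Q u <= t)%R = (u <= F t)%R].
Proof.
move=> nd rc lo hi.
(* The generalised inverse of [F]. The default 0 is harmless: [unif] does not charge the complement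
   of the open unit interval. *)
pose Q (u : measurableTypeR R) : measurableTypeR R :=
  if (0 < u < 1)%R then inf [set t | (u <= F t)%R] else 0%R.
have QE u t : (0 < u < 1)%R -> (Q u <= t)%R = (u <= F t)%R.
  move=> /[dup] u01 /andP[u0 u1]; rewrite /Q u01.
  have lb : has_lbound [set t | (u <= F t)%R].
    have [t0 t0u] := lo _ u0; exists t0 => s/= us.
    by rewrite leNgt; apply/negP => /ltW/nd; rewrite leNgt (lt_le_trans t0u).
  apply/idP/idP => [Qt|ut]; last exact: ge_inf.
  apply: rc => s ts.
  have : has_inf [set t | (u <= F t)%R] by split=> //; have [x] := hi _ u1; exists x.
  have st : (0 < s - t)%R by rewrite subr_gt0.
  move=> /(inf_adherent st)[x /= ux]; rewrite addrC => /ltW xs; apply: (le_trans ux); apply: nd.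
  by apply: (le_trans xs); lra.
exists Q; split=> //.
move=> _; apply: (measurability _ (RGenOInfty.measurableE R)) => //.
move=> _ /= -[_ [t ->] <-]; rewrite setTI.
have -> : Q @^-1` `]t, +oo[%classic = ~` (
    (`]0%R, 1%R[%classic `&` `]-oo, F t]%classic) `|`
    (~` `]0%R, 1%R[%classic `&` [set _ | (0 <= t)%R])).
  apply/seteqP; split=> u; rewrite /preimage/= ?in_itv/= ?andbT; last first.
    move=> h; rewrite ltNge; apply/negP => Qt; apply: h.
    case: (boolP (0 < u < 1)%R) => u01.
      by left; rewrite -QE.
    by right; split=> //; move: Qt; rewrite /Q (negbTE u01).
  move=> tQ [[u01]|[u01 t0]].
    by rewrite -QE// leNgt tQ.
  by move: tQ; rewrite /Q (negbTE (introN idP u01)) ltNge t0.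
apply: measurableC; apply: measurableU; apply: measurableI => //.
  exact: measurableC.
by have [t0|t0] := boolP (0 <= t)%R; [rewrite (_ : [set _ | _] = setT)|
  rewrite (_ : [set _ | _] = set0)] => //; apply/seteqP; split.
Qed.

Lemma quantile_law (F : R -> R) (Q : measurableTypeR R -> measurableTypeR R) t :
  measurable_fun setT Q ->
  (forall u t, (0 < u < 1)%R -> (Q u <= t)%R = (u <= F t)%R) ->
  (0 <= F t <= 1)%R ->
  unif (Q @^-1` `]-oo, t]%classic) = (F t)%:E.
Proof.
move=> mQ QE F01.
have mA : measurable (Q @^-1` `]-oo, t]%classic).
  by rewrite -[X in measurable X]setTI; exact: mQ.
rewrite -(prob1_setI mA (measurable_itv _) unif_oo) -(unif_ray F01).
rewrite -[RHS](prob1_setI (P:=unif) _ _ unif_oo)//; congr (unif _).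
apply/seteqP; split=> u/=; rewrite !in_itv/= => -[h u01].
  by rewrite -QE.
by rewrite QE.
Qed.

(** Image of the uniform law under the quantile of [F]; this is what makes the pointwise limit of
    the iterates a law. *)
Lemma exists_law_of_cdf (F : R -> R) :
  {homo F : s t / (s <= t)%R} ->
  (forall t u, (forall s, (t < s)%R -> (u <= F s)%R) -> (u <= F t)%R) ->
  (forall u, (0 < u)%R -> exists t, (F t < u)%R) ->
  (forall u, (u < 1)%R -> exists t, (u <= F t)%R) ->
  (forall t, (0 <= F t <= 1)%R) ->
  exists nu : probability (measurableTypeR R) R, cdfR nu =1 F.
Proof.
move=> nd rc lo hi F01; have [Q [mQ QE]] := exists_quantile nd rc lo hi.
have [nu nuE] := pushforward_law unif mQ.
by exists nu => t; rewrite /cdfR nuE (quantile_law mQ QE).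
Qed.

Lemma cdfR_rc (nu : probability (measurableTypeR R) R) t u :
  (forall s, (t < s)%R -> (u <= cdfR nu s)%R) -> (u <= cdfR nu t)%R.
Proof.
move=> h.
suff : (fun n : nat => nu `]-oo, (t + n.+1%:R^-1)%R]%classic) @ \oo --> nu `]-oo, t]%classic.
  move=> cv; rewrite -lee_fin cdfRE -(cvg_lim _ cv)//.
  apply: lime_ge; first by apply/cvg_ex; eexists; exact: cv.
  by near=> n; rewrite -cdfRE lee_fin h// ltrDl invr_gt0.
rewrite (itvNycEbigcap false).
apply: nonincreasing_cvg_mu => //.
- by rewrite (le_lt_trans (probability_le1 _ _)) ?ltry.
- exact: bigcap_measurable.
- move=> m n mn; apply/subsetPset; apply: subset_itvl.
  by rewrite bnd_simp lerD2l lef_pV2 ?posrE// ler_nat.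
Unshelve. all: by end_near. Qed.

Lemma cdfR_lo (nu : probability (measurableTypeR R) R) u :
  (0 < u)%R -> exists t, (cdfR nu t < u)%R.
Proof.
move=> u0; have [X XE] := exists_RV nu
  (@measurable_id _ _ setT : measurable_fun setT (idfun : measurableTypeR R -> R)).
have /fine_cvg := cvg_cdfNy0 X => /cvgr_lt /(_ _ u0) h.
have [r hr] := @filter_ex _ _ _ _ h; exists r.
by move: hr; rewrite /cdfR /cdf /distribution/= /pushforward XE.
Qed.

Lemma cdfR_hi (nu : probability (measurableTypeR R) R) u :
  (u < 1)%R -> exists t, (u <= cdfR nu t)%R.
Proof.
move=> u1; have [X XE] := exists_RV nu
  (@measurable_id _ _ setT : measurable_fun setT (idfun : measurableTypeR R -> R)).
have /fine_cvg := cvg_cdfy1 X => /cvgr_ge /(_ _ u1) h.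
have [r hr] := @filter_ex _ _ _ _ h; exists r.
by move: hr; rewrite /cdfR /cdf /distribution/= /pushforward XE.
Qed.

Lemma exists_quantile_law (nu : probability (measurableTypeR R) R) :
  exists Q : measurableTypeR R -> measurableTypeR R, measurable_fun setT Q /\
    forall A, measurable A -> unif (Q @^-1` A) = nu A.
Proof.
have [Q [mQ QE]] := exists_quantile (@cdfR_nd _ nu) (@cdfR_rc nu)
  (@cdfR_lo nu) (@cdfR_hi nu).
have [mu muE] := pushforward_law unif mQ.
exists Q; split=> // A mA; rewrite -muE; apply: eq_cdfR => // t.
by rewrite /cdfR muE (quantile_law mQ QE) ?cdfR_ge0 ?cdfR_le1.
Qed.

End Quantile.

Lemma measurable_iter d (T : measurableType d) (b : T -> T) k :
  measurable_fun setT b -> measurable_fun setT (iter k b).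
Proof.
move=> mb; elim: k => [|k IHk] /=; first exact: measurable_id.
exact: measurableT_comp.
Qed.

(** * Independence from pi-systems and along iterates *)

Section Independence.
Context d (T : measurableType d) (R : realType) (P : probability T R).

(** As functions of [A], both sides are finite measures: the image under [X] of [P] restricted to
    [E], and a multiple of the law of [X]. They agree on a generating pi-system. *)
Lemma indep_extend d1 (T1 : measurableType d1) (X : T -> T1) (E : set T)
    (G : set (set T1)) :
  measurable_fun setT X -> measurable E ->
  @measurable _ T1 = <<s G >> -> setI_closed G -> G setT ->
  (forall A, G A -> P (X @^-1` A `&` E) = P (X @^-1` A) * P E) ->
  forall A, measurable A -> P (X @^-1` A `&` E) = P (X @^-1` A) * P E.
Proof.
move=> mX mE mG GI GT h A mA.
have PE0 : (0 <= fine (P E))%R by rewrite fine_ge0.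
pose r := NngNum PE0.
have [m1 m1E] := exists_pushforward (mrestr P mE) mX.
have [m m_E] := exists_pushforward P mX.
pose m2 : {measure set T1 -> \bar R} := mscale r m.
have m2E B : m2 B = P (X @^-1` B) * P E.
  by rewrite /m2/= /mscale/= fineK ?fin_num_measure// muleC m_E.
rewrite -m2E; suff : m1 A = m2 A by rewrite m1E.
apply: (measure_unique G (fun=> setT)) => //.
- by rewrite bigcup_const.
- by move=> B GB; rewrite m1E m2E -h.
- by move=> _; rewrite m1E /= /mrestr preimage_setT setTI (le_lt_trans (probability_le1 _ _)) ?ltry.
Qed.

Lemma indep_extend2 d1 (T1 : measurableType d1) d2 (T2 : measurableType d2)
    (X : T -> T1) (Y : T -> T2) (G : set (set T1)) (H : set (set T2)) :
  measurable_fun setT X -> measurable_fun setT Y ->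
  @measurable _ T1 = <<s G >> -> setI_closed G -> G setT ->
  @measurable _ T2 = <<s H >> -> setI_closed H -> H setT ->
  (forall A B, G A -> H B ->
     P (X @^-1` A `&` Y @^-1` B) = P (X @^-1` A) * P (Y @^-1` B)) ->
  forall A B, measurable A -> measurable B ->
     P (X @^-1` A `&` Y @^-1` B) = P (X @^-1` A) * P (Y @^-1` B).
Proof.
move=> mX mY mG GI GT mH HI HT h A B mA mB.
have mXp C : measurable C -> measurable (X @^-1` C).
  by move=> mC; rewrite -[X in measurable X]setTI; exact: mX.
have mYp C : measurable C -> measurable (Y @^-1` C).
  by move=> mC; rewrite -[X in measurable X]setTI; exact: mY.
have GH C : G C -> measurable C by move=> GC; rewrite mG; exact: sub_sigma_algebra.
have HH C : H C -> measurable C by move=> GC; rewrite mH; exact: sub_sigma_algebra.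
apply: (indep_extend mX (mYp _ mB) mG GI GT) => // C GC.
rewrite setIC muleC.
apply: (indep_extend mY (mXp _ (GH _ GC)) mH HI HT) => // D HD.
by rewrite setIC muleC h.
Qed.

(** The hypothesis says that [a] and [b] are independent and, for [A = setT], that [b] preserves
    [P]. Peeling off the first reading therefore leaves the same problem at [b x]. It serves twice:
    for binary digits and for splitting coins. *)
Lemma indep_iter d1 (T1 : measurableType d1) (a : T -> T1) (b : T -> T) :
  measurable_fun setT a -> measurable_fun setT b ->
  (forall A B, measurable A -> measurable B ->
     P (a @^-1` A `&` b @^-1` B) = P (a @^-1` A) * P B) ->
  forall n (A : nat -> set T1), (forall i, measurable (A i)) ->
  P [set x | forall k, (k < n)%N -> A k (a (iter k b x))] =
  \prod_(k < n) P (a @^-1` A k).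
Proof.
move=> ma mb ab; elim=> [|n IH] A mA.
  by rewrite big_ord0 (_ : [set _ | _] = setT) ?probability_setT//; apply/seteqP; split.
have mS : measurable [set x | forall k, (k < n)%N -> A k.+1 (a (iter k b x))].
  rewrite (_ : [set _ | _] =
      \bigcap_(k in `I_n) ((a \o iter k b) @^-1` A k.+1)); last first.
    by apply/seteqP; split=> x /= h k /h.
  apply: bigcap_measurableType => k _.
  rewrite -[X in measurable X]setTI.
  exact: (measurableT_comp ma (measurable_iter k mb)).
rewrite big_ord_recl/= -(IH (fun k => A k.+1))// -ab//; congr (P _).
apply/seteqP; split=> x /=.
  by move=> h; split; [exact: (h 0%N)|move=> k kn; rewrite -iterSr; exact: (h k.+1)].
by move=> [h0 h] [//|k kn]; rewrite iterSr; exact: h.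
Qed.

End Independence.

(** * Independent sequences from coin tossing *)

Section Bits.
Variable R : realType.
Local Notation mR := (measurableTypeR R).

Definition bit0 (u : mR) : bool := (2^-1 <= u)%R.
(** The doubling map modulo 1, which shifts the binary expansion of [u]. *)
Definition dbl (u : mR) : mR := (if bit0 u then u *+ 2 - 1 else u *+ 2)%R.

Lemma measurable_bit0 : measurable_fun setT bit0.
Proof. exact: measurable_fun_ler. Qed.

Lemma measurable_dbl : measurable_fun setT dbl.
Proof.
apply: measurable_fun_ifT; first exact: measurable_bit0.
- by apply: measurable_funB => //; exact: natmul_measurable.
- exact: natmul_measurable.
Qed.

Lemma unif_itv (a b : R) (x y : bool) (A : set R) : measurable A ->
  (a <= b)%R ->
  A `&` `[0%R, 1%R]%classic = [set` Interval (BSide x a) (BSide y b)] ->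
  unif R A = (b - a)%:E.
Proof.
move=> mA ab; rewrite unifE// => ->; rewrite lebesgue_measure_itv/= lte_fin.
case: ltP => [_|ba]; first by rewrite EFinB.
by rewrite (_ : b = a) ?subrr//; apply/eqP; rewrite eq_le ab ba.
Qed.

Lemma unif_eq0 (A : set R) : measurable A ->
  A `&` `[0%R, 1%R]%classic = set0 -> unif R A = 0.
Proof. by move=> mA A0; rewrite unifE// A0 measure0. Qed.

Lemma unif_bit0 (b : bool) : unif R (bit0 @^-1` [set b]) = (2^-1)%:E.
Proof.
have mb : measurable (bit0 @^-1` [set b]).
  by rewrite -[X in measurable X]setTI; exact: measurable_bit0.
case: b mb => mb.
- rewrite (@unif_itv 2^-1%R 1%R true false)//; [congr EFin; lra|lra|].
  apply/seteqP; split=> u /=; rewrite !in_itv/= /bit0.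
    by move=> [-> /andP[_ ->]].
  by move=> /andP[h ->]; rewrite h; split=> //; lra.
- rewrite (@unif_itv 0%R 2^-1%R true true)//; [by rewrite subr0|].
  apply/seteqP; split=> u /=; rewrite !in_itv/= /bit0.
    by move=> [/negbT]; rewrite -ltNge => -> /andP[->].
  by move=> /andP[u0 u1]; split; [apply/negbTE; rewrite -ltNge|lra].
Qed.

(** On each half of the unit interval [dbl] is affine of slope 2 and covers the unit interval up to
    an end point, so the image of the restricted uniform law is half of the uniform law. Comparing
    the two on rays suffices. *)
Lemma bit0_dbl_half (b : bool) (B : set mR) : measurable B ->
  unif R (dbl @^-1` B `&` bit0 @^-1` [set b]) = (2^-1)%:E * unif R B.
Proof.
move=> mB.
have mb : measurable (bit0 @^-1` [set b]).
  by rewrite -[X in measurable X]setTI; exact: measurable_bit0.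
have md C : measurable C -> measurable (dbl @^-1` C).
  by move=> mC; rewrite -[X in measurable X]setTI; exact: measurable_dbl.
have [m mE] := exists_pushforward (mrestr (unif R) mb) measurable_dbl.
have r0 : (0 <= 2^-1 :> R)%R by [].
pose m2 : {measure set mR -> \bar R} := mscale (NngNum r0) (unif R).
suff : m B = m2 B by rewrite mE.
apply: eq_measure_rays => //.
- by rewrite mE /= /mrestr preimage_setT setTI (le_lt_trans (probability_le1 _ _)) ?ltry.
- by rewrite mE /= /mrestr preimage_setT setTI /m2 /= /mscale/= probability_setT mule1 unif_bit0.
move=> t; rewrite mE /= /mrestr /m2 /= /mscale/=.
have mD : measurable (dbl @^-1` `]-oo, t]%classic `&` bit0 @^-1` [set b]).
  by apply: measurableI => //; exact: md.
have [t0|t0] := ltP t 0%R.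
  rewrite !unif_eq0 ?mule0//.
  - rewrite -subset0 => u /= []; rewrite !in_itv/=; lra.
  - rewrite -subset0 => u /= [[]]; rewrite !in_itv/= /dbl => + _.
    by rewrite /bit0; case: ifPn; lra.
(* The case [t >= 1] stands apart because for digit 0 the bound [t / 2] no longer lies below the cut
   at 1/2. *)
have [t1|t1] := leP 1%R t.
  have -> : unif R `]-oo, t]%classic = 1.
    rewrite -[RHS]/(1%:E) -[X in X%:E]subr0; apply: (@unif_itv _ _ true false) => //.
    by apply/seteqP; split=> u /=; rewrite !in_itv/=; lra.
  rewrite mule1 -(unif_bit0 b) !unifE//; congr (lebesgue_measure _).
  apply/seteqP; split=> u /=; rewrite !in_itv/= /dbl.
    by move=> [[_ ->]] ->.
  move=> [hb /andP[u0 u1]]; split; last by rewrite u0.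
  by split=> //; rewrite /bit0; case: ifPn; lra.
rewrite unif_ray ?t0 ?(ltW t1)//.
case: b mb mD {mE m m2} => mb mD.
- rewrite (@unif_itv 2^-1%R ((1 + t) / 2)%R true false)//.
  + by rewrite -EFinM; congr EFin; lra.
  + lra.
  + apply/seteqP; split=> u /=; rewrite !in_itv/= /dbl /bit0.
    * by move=> [[+ h]]; rewrite h; lra.
    * by case: ifPn => h1 h2; (split; [split|]); move: h1 h2; lra.
- rewrite (@unif_itv 0%R (t / 2)%R true false)//.
  + by rewrite subr0 -EFinM; congr EFin; lra.
  + lra.
  + apply/seteqP; split=> u /=; rewrite !in_itv/= /dbl /bit0.
    * by move=> [[+ h]]; rewrite h; lra.
    * by case: ifPn => h1 h2; (split; [split|]); move: h1 h2; lra.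
Qed.

Lemma bit0_dbl_indep (A : set bool) (B : set mR) : measurable B ->
  unif R (bit0 @^-1` A `&` dbl @^-1` B) = unif R (bit0 @^-1` A) * unif R B.
Proof.
move=> mB.
have md : measurable (dbl @^-1` B).
  by rewrite -[X in measurable X]setTI; exact: measurable_dbl.
have mb b : measurable (bit0 @^-1` [set b]).
  by rewrite -[X in measurable X]setTI; exact: measurable_bit0.
rewrite setIC.
have key b : A = [set b] ->
    unif R (dbl @^-1` B `&` bit0 @^-1` A) = unif R (bit0 @^-1` A) * unif R B.
  by move=> ->; rewrite bit0_dbl_half// unif_bit0.
have [At|At] := pselect (A true); have [Af|Af] := pselect (A false).
- have -> : A = setT by apply/seteqP; split=> // -[].
  rewrite preimage_setT setIT probability_setT mul1e.
  have -> : dbl @^-1` B = (dbl @^-1` B `&` bit0 @^-1` [set true]) `|`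
      (dbl @^-1` B `&` bit0 @^-1` [set false]).
    apply/seteqP; split=> u /=; last by case=> -[].
    by move=> Bu; case: (bit0 u); [left|right].
  rewrite measureU; [|exact: measurableI..|].
    transitivity ((2^-1)%:E * unif R B + (2^-1)%:E * unif R B).
      by congr (_ + _); exact: bit0_dbl_half.
    rewrite -ge0_muleDl// -EFinD.
    by rewrite (_ : (_ + _)%R = 1%R) ?mul1e//; lra.
  by rewrite -subset0 => u /= [[_ ->] [_]].
- by apply: (key true); apply/seteqP; split=> -[].
- by apply: (key false); apply/seteqP; split=> -[].
- have -> : A = set0 by apply/seteqP; split=> -[].
  by rewrite preimage_set0 setI0 measure0 mul0e.
Qed.

End Bits.

Section CoinTossing.
Variable R : realType.
Local Notation mR := (measurableTypeR R).

Definition box (A : nat -> set bool) : set (nat -> bool) :=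
  [set x | forall i, A i (x i)].

(** Cylinders: only finitely many coordinates are constrained. They form a pi-system and generate
    the sigma-algebra put on [coins]. *)
Definition boxes : set (set (nat -> bool)) :=
  [set B | exists A n, (forall i, (n <= i)%N -> A i = setT) /\ B = box A].

Definition coins := g_sigma_algebraType boxes.

Lemma boxes_setI : setI_closed boxes.
Proof.
move=> _ _ [A [n [hA ->]]] [B [m [hB ->]]].
exists (fun i => A i `&` B i), (maxn n m); split=> [i|].
  by rewrite geq_max => /andP[ni mi]; rewrite hA// hB// setIT.
by apply/seteqP; split=> x /=; [move=> [h1 h2] i; split|move=> h; split=> i; have [] := h i].
Qed.

Lemma boxes_setT : boxes setT.
Proof. by exists (fun=> setT), 0%N; split=> //; apply/seteqP; split. Qed.

Lemma measurable_coin i : measurable_fun setT (fun x : coins => x i).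
Proof.
move=> _ B _; rewrite setTI; apply: sub_sigma_algebra.
exists (fun k => if k == i then B else setT), i.+1; split=> [k|].
  by move=> ik; rewrite gtn_eqF.
apply/seteqP; split=> x /=; last by move=> /(_ i) /=; rewrite eqxx.
by move=> Bx k /=; case: eqP => [->|].
Qed.

Lemma measurable_to_coins d (T : measurableType d) (f : T -> coins) :
  (forall i, measurable_fun setT (fun x => f x i)) -> measurable_fun setT f.
Proof.
move=> mf; apply: (@measurability _ _ T coins setT f boxes) => //.
move=> _ [_ [A [n [hA ->]]] <-]; rewrite setTI.
rewrite (_ : _ @^-1` _ = \bigcap_i ((fun x => f x i) @^-1` A i)); last first.
  by apply/seteqP; split=> x /= h i; [move=> _|]; exact: h.
by apply: bigcapT_measurable => i; rewrite -[X in measurable X]setTI; exact: mf.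
Qed.

Definition bits (u : mR) : coins := fun k => bit0 (iter k (@dbl R) u).

Lemma measurable_bits : measurable_fun setT bits.
Proof.
apply: measurable_to_coins => k.
apply: measurableT_comp; first exact: measurable_bit0.
exact: measurable_iter (@measurable_dbl R).
Qed.

Definition partial_val (n : nat) (x : coins) : mR :=
  (\sum_(0 <= i < n) (x i)%:R * 2^-1 ^+ i.+1)%R.

(** The number with binary digits [x], a left inverse of [bits] on the open unit interval. *)
Definition val01 (x : coins) : mR := limn (partial_val ^~ x).

Lemma partial_val_le n x : (partial_val n x <= 1 - 2^-1 ^+ n)%R.
Proof.
elim: n => [|n IH]; first by rewrite /partial_val big_nil expr0 subrr.
rewrite /partial_val big_nat_recr//= -/(partial_val n x) exprS.
have h : (0 <= 2^-1 ^+ n :> R)%R by rewrite exprn_ge0.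
by move: IH; case: (x n) => /=; lra.
Qed.

Lemma partial_val_cvg x : partial_val ^~ x @ \oo --> val01 x.
Proof.
apply: nondecreasing_is_cvgn => [n m nm|].
  apply: (@homo_leq _ (fun n => partial_val n x) <=%R) => //.
    by move=> ? ? ? /le_trans; apply.
  move=> k; rewrite /partial_val big_nat_recr//= lerDl mulr_ge0// exprn_ge0.
exists 1%R => _ [n _ <-]; apply: le_trans (partial_val_le n x) _.
by rewrite gerBl exprn_ge0.
Qed.

Lemma measurable_val01 : measurable_fun setT val01.
Proof.
apply: (measurable_realfun.measurable_fun_cvg (h := partial_val)) => [n|x _];
  last exact: partial_val_cvg.
apply: measurable_sum => i; apply: measurable_funM => //.
apply: (@measurableT_comp _ _ _ _ _ _ (fun b : bool => b%:R%R : mR) _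
  (fun x : coins => x i)) => //.
exact: measurable_coin.
Qed.

(** Since [dbl v] is [2 v] minus the first digit of [v], each iteration moves one digit from the
    remainder to the partial sum. *)
Lemma partial_val_bits n u :
  partial_val n (bits u) = (u - 2^-1 ^+ n * iter n (@dbl R) u)%R.
Proof.
elim: n => [|n IH]; first by rewrite /partial_val big_nil expr0 mul1r subrr.
rewrite /partial_val big_nat_recr//= -/(partial_val n (bits u)) IH.
rewrite /bits /dbl; case: (bit0 _) => /=; rewrite !exprS; lra.
Qed.

Lemma iter_dbl n (u : mR) : (0 < u < 1)%R -> (0 <= iter n (@dbl R) u <= 1)%R.
Proof.
move=> u01; elim: n => [|n] /=; first by move: u01; lra.
by set v := iter _ _ _; rewrite /dbl /bit0; case: ifPn; lra.
Qed.

(** The iterates of [dbl] stay in the unit interval, so the remainder after [n] digits is at most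
    [2^-n]. *)
Lemma val01_bits (u : mR) : (0 < u < 1)%R -> val01 (bits u) = u.
Proof.
move=> u01; apply/cvg_lim => //.
apply: (@squeeze_cvgr _ _ _ _ (fun n => u - 2^-1 ^+ n)%R (cst u)).
- near=> n; rewrite partial_val_bits /=.
  have := iter_dbl n u01; set v := iter _ _ _.
  have h : (0 <= 2^-1 ^+ n :> R)%R by rewrite exprn_ge0.
  move=> /andP[v0 v1]; apply/andP; split; last by rewrite gerBl mulr_ge0.
  by rewrite lerB// ler_piMr.
- rewrite -[X in _ --> X]subr0; apply: cvgB; first exact: cvg_cst.
  apply: cvg_expr; rewrite ger0_norm//; lra.
- exact: cvg_cst.
Unshelve. all: by end_near. Qed.

Definition even_coins (x : coins) : coins := fun k => x k.*2.
Definition odd_coins (x : coins) : coins := fun k => x k.*2.+1.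

Lemma measurable_even_coins : measurable_fun setT even_coins.
Proof. by apply: measurable_to_coins => k; exact: measurable_coin. Qed.

Lemma measurable_odd_coins : measurable_fun setT odd_coins.
Proof. by apply: measurable_to_coins => k; exact: measurable_coin. Qed.

(* A sequence of coins splits into two independent ones with the same law;
   splitting the odd half again and again gives infinitely many. *)
Lemma exists_splitting : exists (P : probability coins R),
  [/\ forall A, measurable A -> P (val01 @^-1` A) = unif R A,
      forall A, measurable A -> P (even_coins @^-1` A) = P A &
      forall A B, measurable A -> measurable B ->
        P (even_coins @^-1` A `&` odd_coins @^-1` B) = P A * P B].
Proof.
have [P PE] := pushforward_law (unif R) measurable_bits.
(* The binary digits of a uniform number are independent fair coins, by [indep_iter] for the
   doubling map. *)
have Pbox A n : (forall i, (n <= i)%N -> A i = setT) ->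
    P (box A) = \prod_(k < n) unif R (@bit0 R @^-1` A k).
  move=> hA; rewrite PE.
  rewrite -(@indep_iter _ _ _ (unif R) _ _ (@bit0 R) (@dbl R)
    (@measurable_bit0 R) (@measurable_dbl R))//.
    congr (unif R _); apply/seteqP; split=> u /=; first by move=> h k _; exact: h.
    by move=> h k; have [kn|nk] := ltnP k n; [exact: h|rewrite hA].
  by move=> C B _ mB; exact: bit0_dbl_indep.
have PI A B n : (forall i, (n <= i)%N -> A i = setT) ->
    (forall i, (n <= i)%N -> B i = setT) ->
    P (even_coins @^-1` box A `&` odd_coins @^-1` box B) = P (box A) * P (box B).
  move=> hA hB.
  rewrite (Pbox A n)// (Pbox B n)//.
  (* Interleaving the constraints: even positions obey [A], odd ones [B]. The intersection becomes a
     single box of length [2 n], whose factors are then regrouped in pairs. *)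
  pose C i := if odd i then B i./2 else A i./2.
  transitivity (P (box C)).
    congr (P _); apply/seteqP; split=> x /=.
      move=> [h1 h2] i; rewrite /C; have := odd_double_half i.
      case: ifPn => _ <-; rewrite ?add1n ?add0n.
        by rewrite /= uphalf_double; exact: h2.
      by rewrite doubleK; exact: h1.
    move=> h; split=> i.
      by have := h i.*2; rewrite /C odd_double doubleK.
    by have := h i.*2.+1; rewrite /C /= odd_double /= uphalf_double.
  rewrite (Pbox C n.*2); last first.
    move=> i ni; have h : (n <= i./2)%N by rewrite geq_half_double.
    by rewrite /C; case: ifP => _; [exact: hB|exact: hA].
  elim: n {hA hB} => [|n IH]; first by rewrite !big_ord0 mule1.
  rewrite doubleS !big_ord_recr/= IH /C /= odd_double /= doubleK uphalf_double.
  by rewrite -!muleA; congr (_ * _); rewrite muleCA.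
have PI2 A B : boxes A -> boxes B ->
    P (even_coins @^-1` A `&` odd_coins @^-1` B) = P A * P B.
  move=> [A' [n [hA ->]]] [B' [m [hB ->]]].
  by apply: (PI _ _ (maxn n m)) => i; rewrite geq_max => /andP[? ?]; [exact: hA|exact: hB].
have Pev A : measurable A -> P (even_coins @^-1` A) = P A.
  have [m mE] := pushforward_law P measurable_even_coins.
  move=> mA; rewrite -mE.
  apply: (@measure_unique _ R coins boxes (fun=> setT)) => //.
  - exact: boxes_setI.
  - by move=> _; exact: boxes_setT.
  - by rewrite bigcup_const.
  - move=> B bB; apply: eq_trans (mE B) _.
    have := PI2 _ _ bB boxes_setT.
    by rewrite preimage_setT setIT probability_setT mule1.
  - by move=> _; exact: le_lt_trans (probability_le1 m measurableT) (ltry _).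
have Pod A : measurable A -> P (odd_coins @^-1` A) = P A.
  have [m mE] := pushforward_law P measurable_odd_coins.
  move=> mA; rewrite -mE.
  apply: (@measure_unique _ R coins boxes (fun=> setT)) => //.
  - exact: boxes_setI.
  - by move=> _; exact: boxes_setT.
  - by rewrite bigcup_const.
  - move=> B bB; apply: eq_trans (mE B) _.
    have := PI2 _ _ boxes_setT bB.
    by rewrite preimage_setT setTI probability_setT mul1e.
  - by move=> _; exact: le_lt_trans (probability_le1 m measurableT) (ltry _).
exists P; split=> // [A mA|A B mA mB].
  have mvA : measurable (val01 @^-1` A).
    by rewrite -[X in measurable X]setTI; exact: measurable_val01.
  have mbvA : measurable (bits @^-1` (val01 @^-1` A)).
    by rewrite -[X in measurable X]setTI; exact: measurable_bits.
  (* Both sides are cut down to the open unit interval, of full mass, where [val01] inverts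
     [bits]. *)
  rewrite PE -(prob1_setI (P := unif R) mbvA _ (unif_oo R))//.
  rewrite -[RHS](prob1_setI (P := unif R) mA _ (unif_oo R))//.
  congr (unif R _); apply/seteqP; split=> u /=; rewrite in_itv/= => -[+ u01];
    by rewrite val01_bits.
rewrite -(Pev A)// -(Pod B)//.
apply: (@indep_extend2 _ _ _ P _ _ _ _ even_coins odd_coins boxes boxes) => //.
- exact: measurable_even_coins.
- exact: measurable_odd_coins.
- exact: boxes_setI.
- exact: boxes_setT.
- exact: boxes_setI.
- exact: boxes_setT.
- move=> C D bC bD; rewrite PI2// Pev ?Pod//; exact: sub_sigma_algebra.
Qed.

(** The [k]-th variable reads the even coins of what remains after [k] passages to the odd half.
    Independence is [indep_iter] again, with splitting in place of doubling. *)
Lemma exists_iid_uniform : exists (P : probability coins R) (U : nat -> coins -> mR),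
  (forall k, measurable_fun setT (U k)) /\
  forall n (A : nat -> set mR), (forall i, measurable (A i)) ->
  P [set x | forall k, (k < n)%N -> A k (U k x)] = \prod_(k < n) unif R (A k).
Proof.
have [P [Pv Pe Peo]] := exists_splitting.
exists P, (fun k => val01 \o even_coins \o iter k odd_coins); split.
  move=> k; apply: measurableT_comp.
    by apply: measurableT_comp; [exact: measurable_val01|exact: measurable_even_coins].
  exact: measurable_iter measurable_odd_coins.
move=> n A mA.
have mvA i : measurable (val01 @^-1` A i).
  by rewrite -[X in measurable X]setTI; exact: measurable_val01.
transitivity (\prod_(k < n) P (even_coins @^-1` (val01 @^-1` A k))); last first.
  by apply: eq_bigr => k _; rewrite Pe// Pv.
apply: (@indep_iter _ _ _ P _ _ even_coins odd_coins _ _ _ n (fun k => val01 @^-1` A k)) => //.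
- exact: measurable_even_coins.
- exact: measurable_odd_coins.
- by move=> B C mB mC; rewrite Peo// Pe.
Qed.

End CoinTossing.

(** * Generating functions *)

Section Pgf.
Variables (R : realType) (p : probability nat R).
Implicit Types x y : R.

Definition pgf x : R := fine (\int[p]_n (x ^+ n)%:E).

Let expr_ge0 x n : (0 <= x <= 1)%R -> 0 <= (x ^+ n)%:E.
Proof. by move=> /andP[x0 _]; rewrite lee_fin exprn_ge0. Qed.

Let expr_le1 x n : (0 <= x <= 1)%R -> (x ^+ n)%:E <= 1.
Proof. by move=> /andP[x0 x1]; rewrite lee_fin exprn_ile1. Qed.

Let int_le1 (f : nat -> \bar R) : (forall n, 0 <= f n) -> (forall n, f n <= 1) ->
  \int[p]_n f n <= 1.
Proof.
move=> f0 f1; apply: (@le_trans _ _ (\int[p]_n cst 1 n)).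
  by apply: ge0_le_integral => //= n _.
by rewrite integral_cst// mul1e probability_le1.
Qed.

Lemma pgfE x : (0 <= x <= 1)%R -> (pgf x)%:E = \int[p]_n (x ^+ n)%:E.
Proof.
move=> x01; rewrite fineK// ge0_fin_numE.
  by rewrite (le_lt_trans (int_le1 _ _)) ?ltry// => n; [exact: expr_ge0|exact: expr_le1].
by apply: integral_ge0 => n _; exact: expr_ge0.
Qed.

Lemma pgf_ge0 x : (0 <= x <= 1)%R -> (0 <= pgf x)%R.
Proof.
by move=> x01; rewrite fine_ge0//; apply: integral_ge0 => n _; exact: expr_ge0.
Qed.

Lemma pgf1 : pgf 1 = 1%R.
Proof.
apply: EFin_inj; rewrite pgfE ?ler01 ?lexx//.
under eq_integral do rewrite expr1n.
by rewrite integral_cst// mul1e; exact: probability_setT.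
Qed.

Lemma integral_nat_series (f : nat -> \bar R) : (forall n, 0 <= f n) ->
  \int[p]_n f n = \sum_(0 <= n <oo) f n * p [set n].
Proof.
move=> f0.
have -> : [set: nat] = \bigcup_n [set n].
  by apply/seteqP; split=> // n _; exists n.
rewrite ge0_integral_bigcup//.
  apply: eq_eseriesr => n _; rewrite (eq_integral (cst (f n))).
    by rewrite integral_cst.
  by move=> k; rewrite inE => ->.
by move=> i j _ _ [k [-> ->]].
Qed.

Lemma pgf_series x : (0 <= x <= 1)%R ->
  (pgf x)%:E = \sum_(0 <= n <oo) (x ^+ n)%:E * p [set n].
Proof.
by move=> x01; rewrite pgfE// integral_nat_series// => n; exact: expr_ge0.
Qed.

Lemma le_pgf x y : (0 <= x)%R -> (x <= y)%R -> (y <= 1)%R -> (pgf x <= pgf y)%R.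
Proof.
move=> x0 xy y1; have y0 := le_trans x0 xy; have x1 := le_trans xy y1.
rewrite -lee_fin !pgfE ?x0 ?y0 ?x1//.
apply: ge0_le_integral => //= n _; rewrite lee_fin ?exprn_ge0//.
by rewrite lerXn2r// nnegrE.
Qed.

Lemma pgf_le1 x : (0 <= x <= 1)%R -> (pgf x <= 1)%R.
Proof. by move=> /andP[x0 x1]; rewrite -pgf1 le_pgf. Qed.

(** All the terms of [pgf y - pgf x] are nonnegative, so each of them bounds it from below.
    Positivity and strict monotonicity of [pgf] both follow by choosing a charged [n]. *)
Lemma pgf_gap x y n : (0 <= x)%R -> (x <= y)%R -> (y <= 1)%R ->
  (fine (p [set n]) * (y ^+ n - x ^+ n) <= pgf y - pgf x)%R.
Proof.
move=> x0 xy y1; have y0 := le_trans x0 xy; have x1 := le_trans xy y1.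
have yx k : (0 <= y ^+ k - x ^+ k)%R by rewrite subr_ge0 lerXn2r// nnegrE.
have fin : \int[p]_k (y ^+ k - x ^+ k)%:E \is a fin_num.
  rewrite ge0_fin_numE; last by apply: integral_ge0 => k _; rewrite lee_fin.
  apply: le_lt_trans (ltry 1%R); apply: int_le1 => k; rewrite lee_fin//.
  by rewrite lerBlDr (@le_trans _ _ 1%R) ?exprn_ile1// lerDl exprn_ge0.
have -> : (pgf y - pgf x)%R = fine (\int[p]_k (y ^+ k - x ^+ k)%:E).
  apply/eqP; rewrite subr_eq; apply/eqP; apply: EFin_inj.
  rewrite EFinD (fineK fin) !pgfE ?x0 ?y0 ?x1// -ge0_integralD//=.
  - by apply: eq_integral => k _; rewrite -EFinD subrK.
  - by move=> k _; rewrite lee_fin.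
  - by move=> k _; rewrite lee_fin exprn_ge0.
rewrite -lee_fin (fineK fin).
rewrite EFinM fineK ?fin_num_measure//.
apply: (@le_trans _ _ (\int[p]_(k in [set n]) (y ^+ k - x ^+ k)%:E)).
  rewrite (eq_integral (cst (y ^+ n - x ^+ n)%:E)).
    by rewrite integral_cst// muleC.
  by move=> k; rewrite inE => ->.
by apply: ge0_subset_integral => //= k _; rewrite lee_fin.
Qed.

Lemma exists_atom (A : set nat) : 0 < p A -> exists2 n, A n & 0 < p [set n].
Proof.
move=> pA; apply: contrapT => h; move: pA; rewrite ltNge => /negP; apply.
have -> : A = \bigcup_(n in A) [set n].
  by apply/seteqP; split=> [n An|n [k Ak ->]//]; exists n.
rewrite measure_bigcup//; last by move=> i j _ _ [k [-> ->]].
rewrite eseries0// => n _ /set_mem An; apply/eqP; rewrite -measure_le0 leNgt.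
by apply/negP => pn; apply: h; exists n.
Qed.

(** The term of index 0 of the series, which is [p [set 0]] even at [x = 0] because [0 ^+ 0 = 1]. *)
Lemma pgf_ge_atom0 x : (0 <= x <= 1)%R -> p [set 0%N] <= (pgf x)%:E.
Proof.
move=> /[dup] x01 /andP[x0 _]; rewrite pgf_series//.
have := @nneseries_lim_ge R (fun n => (x ^+ n)%:E * p [set n]) xpredT 0%N 1%N.
rewrite big_nat1 expr0 mul1e; apply => k _ _.
by rewrite mule_ge0// lee_fin exprn_ge0.
Qed.

Lemma pgf_gt0 x : (0 < x)%R -> (x <= 1)%R -> (0 < pgf x)%R.
Proof.
move=> x0 x1.
have [n _ pn] : exists2 n, setT n & 0 < p [set n].
  by apply: exists_atom; rewrite probability_setT.
have pn' : (0 < fine (p [set n]))%R.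
  by rewrite -lte_fin fineK// fin_num_measure.
case: n pn pn' => [|n] pn pn'.
  rewrite -lte_fin (lt_le_trans pn)// pgf_ge_atom0// x1 ltW//.
have := @pgf_gap 0%R x n.+1 (lexx _) (ltW x0) x1.
rewrite expr0n subr0 => h.
have h0 : (0 <= pgf 0)%R by apply: pgf_ge0; rewrite lexx ler01.
have : (0 < fine (p [set n.+1]) * x ^+ n.+1)%R by rewrite mulr_gt0// exprn_gt0.
by move=> hh; rewrite (lt_le_trans hh)// (le_trans h)// gerBl.
Qed.

Lemma lt_pgf x y : p [set 0%N] != 1 -> (0 <= x)%R -> (x < y)%R -> (y <= 1)%R ->
  (pgf x < pgf y)%R.
Proof.
move=> p0 x0 xy y1.
have [[|n] n0 pn] : exists2 n, (~` [set 0%N]) n & 0 < p [set n].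
  apply: exists_atom; rewrite probability_setC// lt_def.
  rewrite sube_eq ?fin_num_measure// add0e eq_sym p0/=.
  by rewrite sube_ge0 ?probability_le1// fin_num_measure.
  by case: n0.
rewrite -subr_gt0; apply: lt_le_trans (pgf_gap n.+1 x0 (ltW xy) y1).
rewrite mulr_gt0//; first by rewrite -lte_fin fineK// fin_num_measure.
by rewrite subr_gt0 ltrXn2r.
Qed.

Lemma pgf_cvg (u : nat -> R) x : (forall k, (0 <= u k <= 1)%R) ->
  u @ \oo --> x -> (fun k => pgf (u k)) @ \oo --> pgf x.
Proof.
move=> u01 ux.
have x01 : (0 <= x <= 1)%R.
  apply/andP; split.
    by rewrite -(cvg_lim _ ux)//; apply: limr_ge; [exact: cvgP ux|near=> k; have /andP[] := u01 k].
  by rewrite -(cvg_lim _ ux)//; apply: limr_le; [exact: cvgP ux|near=> k; have /andP[] := u01 k].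
suff : (fun k => \int[p]_n (u k ^+ n)%:E) @ \oo --> (pgf x)%:E by move/fine_cvg.
rewrite pgfE//.
apply: (@dominated_cvg _ _ _ p setT measurableT _ _ (cst 1)) => //.
- move=> n _; apply: cvg_EFin; first by near=> k.
  exact: (cvg_comp _ _ ux (@exprn_continuous _ n x)).
- exact: finite_measure_integrable_cst.
- by move=> k n _; rewrite gee0_abs ?expr_ge0// expr_le1.
Unshelve. all: by end_near. Qed.

End Pgf.

(** * The law of the right-hand side *)

Section LawOfRhs.
Context (d : measure_display) (Omega : measurableType d) (R : realType).
Variable P : probability Omega R.
Local Notation mR := (measurableTypeR R).

Lemma mutually_independent_seq (I : choiceType) (F : I -> set_system Omega)
    (s : seq I) (A : I -> set Omega) :
  mutually_independent P F -> uniq s -> (forall j, j \in s -> F j (A j)) ->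
  P [set x | forall j, j \in s -> A j x] = \prod_(j <- s) P (A j).
Proof.
move=> indep us FA.
have JE j : (j \in [fset k in s]%fset) = (j \in s) by rewrite inE.
have := indep [fset k in s]%fset A.
rewrite (perm_big s) => [<-|].
- congr (P _); apply/seteqP; split=> x /= h j; [move=> /=; rewrite JE|move=> js]; apply: h => //=.
  by rewrite JE.
- by move=> j; rewrite JE; exact: FA.
- by apply: uniq_perm => // [|j]; rewrite ?fset_uniq.
Qed.

Variables (omega zeta : probability mR R) (p : probability nat R).
Variables (N : {RV P >-> nat}) (w Z : nat -> {RV P >-> mR}).
Hypothesis NE : same_law (distribution P N) p.
Hypothesis wE : forall i, same_law (distribution P (w i)) omega.
Hypothesis ZE : forall i, same_law (distribution P (Z i)) zeta.
Hypothesis indep : mutually_independent P (joint_sigma N w Z).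

Let pair i (x : Omega) : mR * mR := (w i x, Z i x).

Let mpair i : measurable_fun setT (pair i).
Proof. exact: measurable_fun_pair. Qed.

Let mpairI i B : measurable B -> measurable (pair i @^-1` B).
Proof. by move=> mB; rewrite -[X in measurable X]setTI; exact: mpair. Qed.

Let Pw i A : measurable A -> P (w i @^-1` A) = omega A.
Proof. by move=> mA; rewrite -(wE i). Qed.

Let PZ i A : measurable A -> P (Z i @^-1` A) = zeta A.
Proof. by move=> mA; rewrite -(ZE i). Qed.

Let PN A : P (N @^-1` A) = p A.
Proof. by rewrite -NE. Qed.

Let events (n : nat) (A C : nat -> set mR) (k : unit + (nat + nat)) : set Omega :=
  match k with
  | inl _ => N @^-1` [set n]
  | inr (inl i) => w i @^-1` A i
  | inr (inr i) => Z i @^-1` C i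
  end.

Let events_sigma n A C k : (forall i, measurable (A i)) ->
  (forall i, measurable (C i)) -> joint_sigma N w Z k (events n A C k).
Proof.
move=> mA mC; case: k => [u|[i|i]] /=.
- by exists [set n] => //; rewrite setTI.
- by exists (A i) => //; rewrite setTI.
- by exists (C i) => //; rewrite setTI.
Qed.

Let pair_law i B : measurable B -> P (pair i @^-1` B) = (omega \x zeta) B.
Proof.
move=> mB; have [m mE] := exists_pushforward P (mpair i).
rewrite -mE; apply/esym; apply: product_measure_unique => // A C mA mC.
rewrite mE; transitivity (P (w i @^-1` A) * P (Z i @^-1` C)); last first.
  by congr (_ * _); [exact: Pw|exact: PZ].
have := mutually_independent_seq indep
  (s := [:: inr (inl i); inr (inr i)]) (A := events 0 (fun=> A) (fun=> C)).
rewrite big_cons big_seq1 /= => <- //; last by move=> j _; exact: events_sigma.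
congr (P _); apply/seteqP; split=> x /=.
  by move=> [hA hC] j; rewrite !inE => /orP[]/eqP ->.
by move=> h; split; [apply: (h (inr (inl i)))|apply: (h (inr (inr i)))]; rewrite !inE eqxx ?orbT.
Qed.

Let rects_law n m (A C : nat -> set mR) : (forall i, measurable (A i)) ->
  (forall i, measurable (C i)) ->
  P [set x | N x = n /\ forall i, (i < m)%N -> (A i `*` C i) (pair i x)] =
  p [set n] * \prod_(i < m) (omega \x zeta) (A i `*` C i).
Proof.
move=> mA mC.
pose s : seq (unit + (nat + nat)) := inl tt :: ([seq inr (inl i) | i <- iota 0 m] ++
  [seq inr (inr i) | i <- iota 0 m]).
have us : uniq s.
  rewrite /s /= mem_cat negb_or cat_uniq !map_inj_uniq ?iota_uniq/=; try by move=> ? ? [].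
  rewrite !andbT; apply/andP; split.
    by apply/andP; split; apply/mapP => -[].
  by apply/hasPn => _ /mapP[i _ ->]; apply/mapP => -[].
have := mutually_independent_seq indep us (A := events n A C).
rewrite /s big_cons big_cat/= !big_map -big_split/= => h.
transitivity (P [set x | forall j, j \in s -> events n A C j x]).
  congr (P _); apply/seteqP; split=> x /=.
    move=> [Nx hx] j; rewrite /s inE => /orP[/eqP ->//|]; rewrite mem_cat => /orP[] /mapP[i + ->];
    by rewrite mem_iota add0n /= => /hx[].
  move=> hx; split=> [|i im]; first by apply: (hx (inl tt)); rewrite inE eqxx.
  split; [apply: (hx (inr (inl i)))|apply: (hx (inr (inr i)))]; rewrite inE mem_cat/=.
    by apply/orP; left; apply/mapP; exists i => //; rewrite mem_iota.
  by apply/orP; right; apply/mapP; exists i => //; rewrite mem_iota.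
rewrite h; last by move=> j _; exact: events_sigma.
rewrite PN; congr (_ * _).
rewrite -[in LHS](subn0 m) -/(index_iota 0 m) big_mkord; apply: eq_bigr => i _.
by rewrite Pw// PZ// product_measure1E.
Qed.

Let rects : set (set (mR * mR)) :=
  [set A `*` C | A in measurable & C in measurable].

Let rectsI : setI_closed rects.
Proof.
move=> _ _ [A mA [C mC <-]] [A' mA' [C' mC' <-]].
rewrite -setXI; exists (A `&` A'); first exact: measurableI.
by exists (C `&` C') => //; exact: measurableI.
Qed.

Let rectsT : rects setT.
Proof. by exists setT => //; exists setT => //; rewrite setXTT. Qed.

(** Induction on the number [k] of leading events that are arbitrary, the later ones being
    rectangles. The step frees one more event by [indep_extend], the other constraints and [N x = n]
    forming the fixed event [E]; for [k = 0] the formula is the independence hypothesis. *)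
Let pairs_law k : forall n m (B : nat -> set (mR * mR)),
  (forall i, measurable (B i)) ->
  (forall i, (k <= i < m)%N -> rects (B i)) ->
  P [set x | N x = n /\ forall i, (i < m)%N -> B i (pair i x)] =
  p [set n] * \prod_(i < m) (omega \x zeta) (B i).
Proof.
elim: k => [|k IH] n m B mB rB.
  have /choice[A hA] i : exists AC : set mR * set mR,
      [/\ measurable AC.1, measurable AC.2 & (i < m)%N -> B i = AC.1 `*` AC.2].
    have [im|nim] := boolP (i < m)%N; last first.
      by exists (setT, setT); split; [exact: measurableT|exact: measurableT|move/negP: nim].
    by have [A mA [C mC <-]] := rB i im; exists (A, C).
  transitivity (P [set x | N x = n /\ forall i, (i < m)%N -> ((A i).1 `*` (A i).2) (pair i x)]).
    congr (P _); apply/seteqP; split=> x /= -[Nx h]; split=> // i im.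
      by have [_ _ /(_ im) eqB] := hA i; have := h i im; rewrite eqB.
    by have [_ _ /(_ im) ->] := hA i; exact: h.
  rewrite rects_law; try by move=> i; have [] := hA i.
  by congr (_ * _); apply: eq_bigr => i _; have [_ _ /(_ (ltn_ord i)) ->] := hA i.
have [mk|km] := leqP m k.
  apply: IH => // i /andP[ki im]; by have := leq_ltn_trans ki im; rewrite ltnNge mk.
(* The family [B] with its [k]-th member replaced by [D]; taking [D = setT] drops that
   constraint. *)
pose B' (D : set (mR * mR)) i := if i == k then D else B i.
have mB' D i : measurable D -> measurable (B' D i) by rewrite /B'; case: ifP.
have rB' D : rects D -> forall i, (k <= i < m)%N -> rects (B' D i).
  move=> rD i /andP[ki im]; rewrite /B'; case: eqVneq => // ik.
  by apply: rB; rewrite im ltn_neqAle eq_sym ik ki.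
have rM D : rects D -> measurable D.
  by move=> [A mA [C mC <-]]; exact: measurableX.
pose E := [set x | N x = n /\ forall i, (i < m)%N -> B' setT i (pair i x)].
have split_ D : [set x | N x = n /\ forall i, (i < m)%N -> B' D i (pair i x)] =
    pair k @^-1` D `&` E.
  apply/seteqP; split=> x /=; rewrite /E/=.
    move=> [Nx h]; split; first by have := h k km; rewrite /B' eqxx.
    by split=> // i im; have := h i im; rewrite /B'; case: eqP.
  by move=> [Dx [Nx h]]; split=> // i im; have := h i im; rewrite /B'; case: eqP => // ->.
have prodE D : \prod_(i < m) (omega \x zeta) (B' D i) =
    (omega \x zeta) D * \prod_(i < m | i != Ordinal km) (omega \x zeta) (B i).
  rewrite (bigD1 (Ordinal km))//= {1}/B' eqxx; congr (_ * _).
  by apply: eq_bigr => i; rewrite -val_eqE /= /B' => /negbTE ->.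
have T1 : (omega \x zeta) setT = 1.
  by rewrite -setXTT product_measure1E// -[RHS]mule1; congr (_ * _); exact: probability_setT.
have PE : P E = p [set n] * \prod_(i < m | i != Ordinal km) (omega \x zeta) (B i).
  rewrite -[E]setTI -[setT](preimage_setT (pair k)) -split_ IH ?prodE ?T1 ?mul1e//.
    by move=> i; exact: mB'.
  by move=> i; exact: rB'.
have mE : measurable E.
  rewrite (_ : E = N @^-1` [set n] `&` \bigcap_(i in `I_m) (pair i @^-1` B' setT i)).
    apply: measurableI; first by rewrite -[X in measurable X]setTI; exact: measurable_funP.
    by apply: bigcap_measurableType => i _; apply: mpairI; exact: mB'.
  by apply/seteqP; split=> x.
have -> : [set x | N x = n /\ forall i, (i < m)%N -> B i (pair i x)] =
    pair k @^-1` B k `&` E.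
  rewrite -split_; apply/seteqP; split=> x /= -[Nx h]; split=> // i im; have := h i im;
  by rewrite /B'; case: eqP => [->|].
rewrite (@indep_extend _ _ _ P _ _ (pair k) E rects)//.
- by rewrite pair_law// PE muleCA [in RHS](bigD1 (Ordinal km)).
- by rewrite measurable_prod_measurableType.
- move=> D rD; rewrite -split_ IH ?prodE ?PE; last 2 first.
  + by move=> i; apply: mB'; exact: rM.
  + exact: rB'.
  rewrite muleCA; congr (_ * _); apply/esym; apply: pair_law; exact: rM.
Qed.

Let below t := [set x : mR * mR | (x.1 - x.2 <= t)%R].

Let measurable_below t : measurable (below t).
Proof.
rewrite -[X in measurable X]setTI.
have mf : measurable_fun setT (fun x : mR * mR => x.1 - x.2 : mR)%R.
  exact: measurable_funB.
have := mf measurableT `]-oo, t]%classic (measurable_itv _).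
by congr (measurable (_ `&` _)); apply/seteqP; split=> x /=; rewrite in_itv.
Qed.

Let rhs_rayE t : (0 <= t)%R ->
  rde_rhs N w Z @^-1` `]-oo, t]%classic =
  \bigcup_n [set x | N x = n /\ forall i, (i < n)%N -> below t (pair i x)].
Proof.
move=> t0; apply/seteqP; split=> x /=; rewrite in_itv/= /rde_rhs.
  move=> /bigmax_leP[_ h]; exists (N x) => //=; split=> // i im.
  exact: (h (Ordinal im)).
by move=> [n _ /= [<- h]]; apply/bigmax_leP; split=> // i _; exact: h.
Qed.

Let rhs_ray0 t : (t < 0)%R -> rde_rhs N w Z @^-1` `]-oo, t]%classic = set0.
Proof.
move=> t0; rewrite -subset0 => x /=; rewrite in_itv/= /rde_rhs => /bigmax_leP[+ _].
by rewrite leNgt t0.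
Qed.

Let measurable_piece t n :
  measurable [set x | N x = n /\ forall i, (i < n)%N -> below t (pair i x)].
Proof.
rewrite (_ : [set _ | _] = N @^-1` [set n] `&` \bigcap_(i in `I_n) (pair i @^-1` below t)).
  apply: measurableI; first by rewrite -[X in measurable X]setTI; exact: measurable_funP.
  by apply: bigcap_measurableType => i _; exact: mpairI.
by apply/seteqP; split=> x.
Qed.

Lemma measurable_rhs : measurable_fun setT (rde_rhs N w Z : Omega -> mR).
Proof.
apply: (@measurability _ _ Omega mR _ _ _ (RGenOInfty.measurableE R)).
move=> _ /= -[_ [t ->] <-]; rewrite setTI -[X in measurable X]setCK.
apply: measurableC; rewrite (_ : ~` _ = rde_rhs N w Z @^-1` ~` `]t, +oo[%classic)// setCitvr.
have [t0|t0] := ltP t 0%R; first by rewrite rhs_ray0.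
by rewrite rhs_rayE//; exact: bigcup_measurable.
Qed.

(** For [t >= 0] the maximum is at most [t] exactly when every difference is. On [N x = n] this
    gives [p [set n]] times the [n]-th power of one probability, and summing over [n] yields the
    generating function. For [t < 0] the neutral element 0 of the maximum empties the event. *)
Lemma rhs_law t :
  P (rde_rhs N w Z @^-1` `]-oo, t]%classic) =
  (if (0 <= t)%R then pgf p (fine ((omega \x zeta) [set x | (x.1 - x.2 <= t)%R])) else 0%R)%:E.
Proof.
case: ifPn => [t0|]; last by rewrite -ltNge => t0; rewrite rhs_ray0// measure0.
rewrite -/(below t); set D := below t; have mD : measurable D := measurable_below t.
have Dle1 : (omega \x zeta) D <= 1 by rewrite -(pair_law 0%N mD) probability_le1//; exact: mpairI.
have Dfin : (omega \x zeta) D \is a fin_num.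
  by rewrite -(pair_law 0%N mD) fin_num_measure//; exact: mpairI.
rewrite pgf_series; last by rewrite fine_ge0//= -lee_fin fineK.
rewrite rhs_rayE// measure_bigcup//; last by move=> i j _ _ [x [/= [<- _] [<- _]]].
rewrite (eq_eseriesl (Q := xpredT)); last by move=> n; rewrite in_setT.
apply: eq_eseriesr => n _.
transitivity (p [set n] * \prod_(i < n) (omega \x zeta) D).
  apply: (@pairs_law n n n (fun=> D)) => //.
  by move=> i /andP[ni /(leq_ltn_trans ni)]; rewrite ltnn.
rewrite muleC; congr (_ * _).
elim: n => [|n IH]; first by rewrite big_ord0.
by rewrite big_ord_recr/= IH exprSr EFinM fineK.
Qed.

End LawOfRhs.

(** * A coin-tossing space that carries N, the w_i and the Z_i *)

Section Families.
Variable R : realType.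
Local Notation mR := (measurableTypeR R).

Lemma measurable_truncn : measurable_fun setT (fun x : mR => Num.truncn x).
Proof.
apply: (@measurability _ _ mR nat setT _ NGenCInfty.G).
  exact: NGenCInfty.measurableE.
move=> _ /= -[_ [[|n] ->] <-]; rewrite setTI.
  by rewrite (_ : _ @^-1` _ = setT)//; apply/seteqP; split=> x //= _; rewrite in_itv.
rewrite (_ : _ @^-1` _ = `[n.+1%:R, +oo[%classic)//.
by apply/seteqP; split=> x /=; rewrite !in_itv/= !andbT -truncn_gt_nat.
Qed.

(** The finite index set is enclosed in an initial segment, with the constraint [setT] at the
    missing indices. *)
Lemma iid_subfamily d (T : measurableType d) (P : probability T R) (U : nat -> T -> mR) :
  (forall n (A : nat -> set mR), (forall i, measurable (A i)) ->
    P [set x | forall k, (k < n)%N -> A k (U k x)] = \prod_(k < n) unif R (A k)) ->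
  forall (s : seq nat) (A : nat -> set mR), uniq s -> (forall i, measurable (A i)) ->
    P [set x | forall k, k \in s -> A k (U k x)] = \prod_(k <- s) unif R (A k).
Proof.
move=> iid s A us mA.
pose n := (\max_(k <- s) k).+1.
have sn k : k \in s -> (k < n)%N by move=> ks; rewrite ltnS leq_bigmax_seq.
pose B k := if k \in s then A k else setT.
transitivity (P [set x | forall k, (k < n)%N -> B k (U k x)]).
  congr (P _); apply/seteqP; split=> x /= h k.
    by move=> kn; rewrite /B; case: ifPn => // ks; exact: h.
  by move=> ks; have := h k (sn _ ks); rewrite /B ks.
rewrite iid; last by move=> i; rewrite /B; case: ifP.
rewrite -(big_mkord xpredT (fun k => unif R (B k))).
rewrite (bigID (mem s))/= [X in _ * X]big1 ?mule1; last first.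
  by move=> k ks; rewrite /B (negbTE ks) probability_setT.
have pE : perm_eq [seq k <- index_iota 0 n | k \in s] s.
  apply: uniq_perm => //; first by rewrite filter_uniq// iota_uniq.
  move=> k; rewrite mem_filter mem_index_iota.
  by case: (boolP (k \in s)) => //= /sn.
rewrite -big_filter (perm_big _ pE)/=.
by rewrite big_seq [RHS]big_seq; apply: eq_bigr => k ks; rewrite /B ks.
Qed.

Lemma exists_family (omega zeta : probability mR R) (p : probability nat R) :
  exists (P : probability coins R) (N : {RV P >-> nat}) (w Z : nat -> {RV P >-> mR}),
  [/\ same_law (distribution P N) p,
      forall i, same_law (distribution P (w i)) omega,
      forall i, same_law (distribution P (Z i)) zeta &
      mutually_independent P (joint_sigma N w Z)].
Proof.
have [P [U [mU iid]]] := exists_iid_uniform R.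
have iids := iid_subfamily iid.
have UE k A : measurable A -> P (U k @^-1` A) = unif R A.
  move=> mA; have := iids [:: k] (fun=> A) isT (fun=> mA).
  rewrite big_seq1 => <-; congr (P _); apply/seteqP; split=> x /=.
    by move=> h j; rewrite inE => /eqP ->.
  by apply; rewrite inE.
(* Quantiles live on the real line, so [p] is pushed there by the inclusion of the integers and
   brought back by [Num.truncn]. *)
have mnat : measurable_fun setT (fun n : nat => n%:R : mR) by [].
have [nu nuE] := pushforward_law p mnat.
have [Qp [mQp QpE]] := exists_quantile_law nu.
have [Qw [mQw QwE]] := exists_quantile_law omega.
have [QZ [mQZ QZE]] := exists_quantile_law zeta.
(* An injective numbering of the whole family: distinct members read distinct uniform variables. *)
pose idx (j : unit + (nat + nat)) : nat := choice.pickle j.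
have mtr : measurable_fun setT ((fun x : mR => Num.truncn x) \o Qp).
  by apply: measurableT_comp => //; exact: measurable_truncn.
have [N NE] : exists N : {RV P >-> nat},
    N = (fun x => Num.truncn (Qp (U (idx (inl tt)) x))) :> (coins -> nat).
  apply: exists_RV; exact: (measurableT_comp mtr).
have /choice[w wE] i : exists W : {RV P >-> mR},
    W = (fun x => Qw (U (idx (inr (inl i))) x)) :> (coins -> mR).
  by apply: exists_RV; exact: (measurableT_comp mQw).
have /choice[Z ZE] i : exists W : {RV P >-> mR},
    W = (fun x => QZ (U (idx (inr (inr i))) x)) :> (coins -> mR).
  by apply: exists_RV; exact: (measurableT_comp mQZ).
exists P, N, w, Z; split.
- move=> A mA; rewrite /distribution /= /pushforward NE.
  transitivity (P (U (idx (inl tt)) @^-1` (Qp @^-1` ((fun x : mR => Num.truncn x) @^-1` A)))) => //.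
  have mtA : measurable ((fun x : mR => Num.truncn x) @^-1` A).
    by rewrite -[X in measurable X]setTI; exact: measurable_truncn.
  rewrite UE; last by rewrite -[X in measurable X]setTI; exact: mQp.
  rewrite QpE// nuE; congr (p _); apply/seteqP; split=> n /=; rewrite natrK//.
- move=> i A mA; rewrite /distribution /= /pushforward wE.
  transitivity (P (U (idx (inr (inl i))) @^-1` (Qw @^-1` A))) => //.
  by rewrite UE ?QwE//; rewrite -[X in measurable X]setTI; exact: mQw.
- move=> i A mA; rewrite /distribution /= /pushforward ZE.
  transitivity (P (U (idx (inr (inr i))) @^-1` (QZ @^-1` A))) => //.
  by rewrite UE ?QZE//; rewrite -[X in measurable X]setTI; exact: mQZ.
- move=> J A JA.
  (* Each event [A j] is expressed through the uniform variable of number [idx j]; numbers outside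
     the family receive [setT]. *)
  have /choice[C hC] k : exists C : set mR, measurable C /\
      forall j, j \in J -> idx j = k -> A j = U k @^-1` C.
    have [[j [jJ jk]]|nj] := pselect (exists j, j \in J /\ idx j = k); last first.
      by exists setT; split=> // j jJ jk; exfalso; apply: nj; exists j.
    have [C mC AC] : exists2 C, measurable C & A j = U k @^-1` C.
      have := JA j jJ; rewrite -jk; case: j {jJ jk} => [[]|[i|i]] /= [B mB <-]; rewrite setTI.
      - exists (Qp @^-1` ((fun x : mR => Num.truncn x) @^-1` B)).
          rewrite -[X in measurable X]setTI; apply: mQp => //.
          by rewrite -[X in measurable X]setTI; exact: measurable_truncn.
        by rewrite NE.
      - exists (Qw @^-1` B); first by rewrite -[X in measurable X]setTI; exact: mQw.
        by rewrite wE.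
      - exists (QZ @^-1` B); first by rewrite -[X in measurable X]setTI; exact: mQZ.
        by rewrite ZE.
    exists C; split=> // j' j'J j'k; rewrite -AC; congr A.
    apply: (pcan_inj (@choice.pickleK (unit + (nat + nat))%type)).
    by rewrite -/(idx j') -/(idx j) j'k.
  have mC k : measurable (C k) by have [] := hC k.
  have AE j : j \in J -> A j = U (idx j) @^-1` C (idx j).
    by move=> jJ; have [_ /(_ j jJ erefl)] := hC (idx j).
  have uJ : uniq [seq idx j | j <- J].
    by rewrite map_inj_uniq ?fset_uniq//; exact: (pcan_inj (@choice.pickleK _)).
  transitivity (P [set x | forall k, k \in [seq idx j | j <- J] -> C k (U k x)]).
    congr (P _); apply/seteqP; split=> x /= h.
      by move=> k /mapP[j jJ ->]; have := h j jJ; rewrite AE.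
    by move=> j /= jJ; rewrite AE//=; apply: h; exact: map_f.
  rewrite iids// big_map big_seq [RHS]big_seq; apply: eq_bigr => j jJ.
  by rewrite AE// UE.
Qed.

End Families.

(** * The map on distribution functions *)

Section UnitMass.
Context d (T : measurableType d) (R : realType) (m : {measure set T -> \bar R}).
Hypothesis m1 : m setT = 1.

(** An alias of [m] that carries the proof of unit mass, so that the probability structure can be
    attached to it. *)
Definition unit_mass of (m setT = 1) : set T -> \bar R := m.

HB.instance Definition _ := Measure.copy (unit_mass m1) m.
HB.instance Definition _ := Measure_isProbability.Build _ _ _ (unit_mass m1) m1.

End UnitMass.

Lemma probability_of_measure d (T : measurableType d) (R : realType)
    (m : {measure set T -> \bar R}) : m setT = 1 ->
  exists P : probability T R, forall A, P A = m A.
Proof. by move=> m1; exists (unit_mass m1). Qed.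

Section Products.
Context d1 d2 (T1 : measurableType d1) (T2 : measurableType d2) (R : realType).
Variables (mu : probability T1 R) (nu : probability T2 R).

Lemma product_probability_setT : (mu \x nu) setT = 1.
Proof.
rewrite -setXTT product_measure1E// -[RHS]mule1.
by congr (_ * _); exact: probability_setT.
Qed.

Lemma product_xsection A : measurable A ->
  (mu \x nu) A = \int[mu]_x nu (xsection A x).
Proof. by []. Qed.

(** The product measure is defined through sections at the first coordinate; this order of
    integration requires Tonelli. *)
Lemma product_ysection A : measurable A ->
  (mu \x nu) A = \int[nu]_y mu (ysection A y).
Proof.
move=> mA; rewrite -[A in LHS]setIT -[LHS]integral_indic//.
rewrite fubini_tonelli2//=; last exact/measurable_EFinP.
have := indic_fubini_tonelli_GE mu mA; rewrite /comp => ->.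
by [].
Qed.

End Products.

Section Step.
Variables (R : realType) (omega : probability (measurableTypeR R) R).
Variable p : probability nat R.
Hypothesis omega_atomless : atomless omega.
Local Notation mR := (measurableTypeR R).
Implicit Type zeta : probability mR R.

(* The distribution function of w - Z, for independent w ~ omega and Z ~ zeta. *)
Definition cdf_diff zeta t : R :=
  fine ((omega \x zeta) [set x | (x.1 - x.2 <= t)%R]).

Definition next_cdf zeta t : R :=
  if (0 <= t)%R then pgf p (cdf_diff zeta t) else 0%R.

Lemma measurable_diff :
  measurable_fun setT (fun x : mR * mR => x.1 - x.2 : mR)%R.
Proof. exact: measurable_funB. Qed.

Lemma exists_diff_law zeta : exists mu : probability mR R,
  (forall A, measurable A -> mu A = (omega \x zeta) ((fun x => x.1 - x.2)%R @^-1` A)) /\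
  cdfR mu =1 cdf_diff zeta.
Proof.
have [m mE] := exists_pushforward (omega \x zeta) measurable_diff.
have [mu muE] : exists mu : probability mR R, forall A, mu A = m A.
  by apply: probability_of_measure; apply: eq_trans (mE setT) _; exact: product_probability_setT.
exists mu; split=> [A mA|t]; first by rewrite muE mE.
rewrite /cdfR muE mE /cdf_diff; congr (fine (_ _)).
Qed.

(** By [rhs_law] the right-hand side has distribution function [next_cdf zeta] on every space that
    carries the variables; [exists_family] supplies one for the converse. *)
Lemma rde_solutionP zeta :
  rde_solution omega p zeta <-> cdfR zeta =1 next_cdf zeta.
Proof.
split.
  move=> [d [Om [P [N [w [Z [NE wE ZE indep zE]]]]]]] t.
  by rewrite /cdfR zE// /pushforward (rhs_law NE wE ZE indep).
move=> h; have [P [N [w [Z [NE wE ZE indep]]]]] := exists_family omega zeta p.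
exists _, (coins : measurableType _), P, N, w, Z; split=> // A mA.
have [m mE] := pushforward_law P (measurable_rhs N w Z).
rewrite /pushforward -mE; apply: eq_cdfR => // t.
by rewrite h /cdfR mE (rhs_law NE wE ZE indep).
Qed.

(** [next_cdf zeta] is a distribution function because an actual random variable has it. *)
Lemma exists_next zeta : exists zeta' : probability mR R,
  cdfR zeta' =1 next_cdf zeta.
Proof.
have [P [N [w [Z [NE wE ZE indep]]]]] := exists_family omega zeta p.
have [m mE] := pushforward_law P (measurable_rhs N w Z).
by exists m => t; rewrite /cdfR mE (rhs_law NE wE ZE indep).
Qed.

Lemma measurable_cdf_shift zeta t :
  measurable_fun setT (fun w : mR => (cdfR zeta (w - t))%:E).
Proof.
apply/measurable_EFinP.
apply: (@measurableT_comp _ _ _ _ _ _ (cdfR zeta : mR -> mR)); first exact: cdfR_measurable.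
exact: measurable_funB.
Qed.

(** This is P(w - Z >= t), conditioned on w. In this form it is visibly monotone in the distribution
    function of Z and open to dominated convergence. *)
Definition surv zeta t : R := fine (\int[omega]_w (cdfR zeta (w - t))%:E).

Lemma survE zeta t : (surv zeta t)%:E = \int[omega]_w (cdfR zeta (w - t))%:E.
Proof.
rewrite fineK// ge0_fin_numE.
  apply: (@le_lt_trans _ _ (\int[omega]_w cst 1 w)).
    apply: (@ge0_le_integral _ _ _ omega setT measurableT) => //.
    - by move=> w _; rewrite lee_fin cdfR_ge0.
    - exact: measurable_cdf_shift.
    - by move=> w _; rewrite lee_fin cdfR_le1.
  by rewrite integral_cst// mul1e (le_lt_trans (probability_le1 _ _)) ?ltry.
by apply: integral_ge0 => w _; rewrite lee_fin cdfR_ge0.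
Qed.

(** For each value of Z the section is a single point, which [omega] does not charge. *)
Lemma product_diff_eq0 zeta t :
  (omega \x zeta) [set x : mR * mR | (x.1 - x.2 = t)%R] = 0.
Proof.
set D0 := [set _ | _].
have mD0 : measurable D0.
  rewrite (_ : D0 = (fun x : mR * mR => x.1 - x.2)%R @^-1` [set t])//.
  by rewrite -[X in measurable X]setTI; exact: measurable_diff.
apply: eq_trans (product_ysection omega zeta mD0) _.
rewrite integral0_eq// => z _.
rewrite (_ : ysection D0 z = [set (z + t)%R]) ?omega_atomless//.
apply/seteqP; split=> w /=; rewrite /ysection/= inE /D0/=.
  by move=> <-; lra.
by move=> ->; lra.
Qed.

Lemma cdf_diffE zeta t : cdf_diff zeta t = (1 - surv zeta t)%R.
Proof.
have [Pr PrE] := probability_of_measure (product_probability_setT omega zeta).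
have mI (A : set mR) : measurable A -> measurable ((fun x : mR * mR => x.1 - x.2)%R @^-1` A).
  by move=> mA; rewrite -[X in measurable X]setTI; exact: measurable_diff.
pose D := [set x : mR * mR | (x.1 - x.2 <= t)%R].
pose D0 := [set x : mR * mR | (x.1 - x.2 = t)%R].
pose D' := [set x : mR * mR | (t <= x.1 - x.2)%R].
have mD : measurable D.
  rewrite (_ : D = (fun x : mR * mR => x.1 - x.2)%R @^-1` `]-oo, t]%classic); first exact: mI.
  by apply/seteqP; split=> x /=; rewrite in_itv.
have mD0 : measurable D0.
  by rewrite (_ : D0 = (fun x : mR * mR => x.1 - x.2)%R @^-1` [set t]); first exact: mI.
have mD' : measurable D'.
  rewrite (_ : D' = (fun x : mR * mR => x.1 - x.2)%R @^-1` `[t, +oo[%classic); first exact: mI.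
  by apply/seteqP; split=> x /=; rewrite in_itv/= andbT.
have PD0 : Pr D0 = 0 by rewrite PrE; exact: product_diff_eq0.
have PD' : Pr D' = (surv zeta t)%:E.
  rewrite PrE survE; apply: eq_integral => w _ /=.
  rewrite cdfRE; congr (zeta _); apply/seteqP; split=> z /=;
    rewrite /xsection/= inE /D'/= in_itv/=; lra.
have : Pr D' = Pr (~` D) + Pr D0.
  rewrite -measureU//.
  - congr (Pr _); apply/seteqP; split=> x /=; rewrite /D /D' /D0 /=.
      rewrite le_eqVlt => /orP[/eqP ->|tx]; [by right|left].
      by apply/negP; rewrite -ltNge.
    by move=> [/negP|-> //]; rewrite -ltNge => /ltW.
  - exact: measurableC.
  - by rewrite -subset0 => x /= [+ hx]; rewrite /D /= hx lexx.
rewrite PD0 adde0 probability_setC// PD' => h.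
have : (cdf_diff zeta t)%:E = Pr D.
  by rewrite /cdf_diff -/D -PrE fineK// fin_num_measure.
move=> hD; move: h; rewrite -hD -EFinB => -[->]; lra.
Qed.

Lemma le_surv zeta zeta' t : (forall s, (cdfR zeta s <= cdfR zeta' s)%R) ->
  (surv zeta t <= surv zeta' t)%R.
Proof.
move=> h; rewrite -lee_fin !survE; apply: ge0_le_integral => //.
- by move=> w _; rewrite lee_fin cdfR_ge0.
- exact: measurable_cdf_shift.
- exact: measurable_cdf_shift.
- by move=> w _; rewrite lee_fin.
Qed.

Lemma cdf_diff01 zeta t : (0 <= cdf_diff zeta t <= 1)%R.
Proof.
have [mu [_ muE]] := exists_diff_law zeta.
by rewrite -muE cdfR_ge0 cdfR_le1.
Qed.

Lemma surv01 zeta t : (0 <= surv zeta t <= 1)%R.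
Proof. by have := cdf_diff01 zeta t; rewrite cdf_diffE; lra. Qed.

Lemma le_next_cdf zeta zeta' t : (forall s, (cdfR zeta s <= cdfR zeta' s)%R) ->
  (next_cdf zeta' t <= next_cdf zeta t)%R.
Proof.
move=> h; rewrite /next_cdf; have [_|//] := boolP (0 <= t)%R.
have /andP[h0 h1] := cdf_diff01 zeta t; have /andP[h0' h1'] := cdf_diff01 zeta' t.
by apply: le_pgf => //; rewrite !cdf_diffE lerD2l lerN2 le_surv.
Qed.

Lemma eq_next_cdf zeta zeta' t : cdfR zeta =1 cdfR zeta' ->
  next_cdf zeta t = next_cdf zeta' t.
Proof. by move=> h; apply/eqP; rewrite eq_le !le_next_cdf// => s; rewrite h. Qed.

Lemma surv_cvg (z : nat -> probability mR R) zeta t :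
  (forall s, (fun n => cdfR (z n) s) @ \oo --> cdfR zeta s) ->
  (fun n => surv (z n) t) @ \oo --> surv zeta t.
Proof.
move=> h.
suff : (fun n => \int[omega]_w (cdfR (z n) (w - t))%:E) @ \oo --> (surv zeta t)%:E.
  by move/fine_cvg.
rewrite survE.
apply: (@dominated_cvg _ _ _ omega setT measurableT _ _ (cst 1)) => //.
- by move=> n; exact: measurable_cdf_shift.
- by move=> w _; apply: cvg_EFin; [near=> k|exact: h].
- exact: finite_measure_integrable_cst.
- by move=> n w _; rewrite gee0_abs lee_fin ?cdfR_ge0// cdfR_le1.
Unshelve. all: by end_near. Qed.

Lemma next_cdf_cvg (z : nat -> probability mR R) zeta t :
  (forall s, (fun n => cdfR (z n) s) @ \oo --> cdfR zeta s) ->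
  (fun n => next_cdf (z n) t) @ \oo --> next_cdf zeta t.
Proof.
move=> h; rewrite /next_cdf; have [_|_] := boolP (0 <= t)%R; last exact: cvg_cst.
apply: pgf_cvg => [k|]; first exact: cdf_diff01.
rewrite cdf_diffE; under eq_fun do rewrite cdf_diffE.
by apply: cvgB; [exact: cvg_cst|exact: surv_cvg].
Qed.

End Step.

(** * Alternating iterates and the pair that encloses all solutions *)

Section ExtremalPair.
Variables (R : realType) (omega : probability (measurableTypeR R) R).
Variable p : probability nat R.
Hypothesis omega_atomless : atomless omega.
Local Notation mR := (measurableTypeR R).
Local Notation next_cdf := (next_cdf omega p).

(* next_cdf is antitone, so its iterates from the largest distribution function
   on [0, +oo[ alternate around every solution. *)
Lemma exists_extremal_pair : exists alpha beta : probability mR R,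
  [/\ forall t, (cdfR beta t <= cdfR alpha t)%R,
      cdfR alpha =1 next_cdf beta,
      cdfR beta =1 next_cdf alpha &
      forall zeta, cdfR zeta =1 next_cdf zeta ->
        forall t, (cdfR beta t <= cdfR zeta t <= cdfR alpha t)%R].
Proof.
have /choice[next nextE] := exists_next omega p.
have anti z z' : (forall s, (cdfR z s <= cdfR z' s)%R) ->
    forall t, (cdfR (next z') t <= cdfR (next z) t)%R.
  by move=> h t; rewrite !nextE le_next_cdf.
pose z n := iter n next (\d_(0%R : mR) : probability mR R).
have z0E t : cdfR (z 0%N) t = (0 <= t)%R%:R.
  by rewrite /cdfR /= /dirac /= indicE mem_setE in_itv.
have z0_ge z' t : (cdfR (next z') t <= cdfR (z 0%N) t)%R.
  rewrite z0E nextE /next_cdf; case: (boolP (0 <= t)%R) => //= _.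
  by apply: pgf_le1; exact: cdf_diff01.
(* Two applications of the map preserve order, so the first comparison with [z 0] propagates along
   the even iterates. *)
have ev_dec n t : (cdfR (z n.*2.+2) t <= cdfR (z n.*2) t)%R.
  elim: n t => [|n IH] t; first exact: z0_ge.
  by rewrite doubleS; do 2 apply: (anti _ _).
have odd_le n t : (cdfR (z 1%N) t <= cdfR (z n.*2) t)%R.
  case: n t => [|n] t; first exact: z0_ge.
  by rewrite doubleS; apply: (anti _ _) => s; exact: z0_ge.
have odd_ev n t : (cdfR (z n.*2.+1) t <= cdfR (z n.*2) t)%R.
  elim: n t => [|n IH] t; first exact: z0_ge.
  by rewrite doubleS; do 2 apply: (anti _ _).
pose F t := limn (fun n => cdfR (z n.*2) t).
have Fdec t : {homo (fun n => cdfR (z n.*2) t) : m n / (m <= n)%N >-> (n <= m)%R}.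
  move=> m n; elim: n => [|n IH]; first by rewrite leqn0 => /eqP ->.
  rewrite leq_eqVlt ltnS => /orP[/eqP ->//|/IH]; apply: le_trans.
  by rewrite doubleS ev_dec.
have Fcvg t : (fun n => cdfR (z n.*2) t) @ \oo --> F t.
  apply: nonincreasing_is_cvgn; first exact: Fdec.
  by exists 0%R => _ [n _ <-]; exact: cdfR_ge0.
have Fle n t : (F t <= cdfR (z n.*2) t)%R.
  apply: limr_le; first exact: cvgP (Fcvg t).
  by near=> m; apply: Fdec; near: m; exact: nbhs_infty_ge.
have geF u t : (forall n, u <= cdfR (z n.*2) t)%R -> (u <= F t)%R.
  move=> h; apply: limr_ge; first exact: cvgP (Fcvg t).
  by near=> m; exact: h.
have [alpha alphaE] : exists alpha : probability mR R, cdfR alpha =1 F.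
  apply: exists_law_of_cdf.
  - by move=> s t st; apply: geF => n; rewrite (le_trans (Fle n s))// cdfR_nd.
  - move=> t u h; apply: geF => n; apply: cdfR_rc => s ts.
    exact: le_trans (h s ts) (Fle n s).
  - move=> u u0; exists (- 1)%R; apply: le_lt_trans (Fle 0%N _) _.
    by rewrite (z0E (-1)%R) (_ : (0 <= -1 :> R)%R = false)//; apply/negbTE; rewrite -ltNge; lra.
  (* No mass escapes to +oo in the limit, since [z 1] lies below all the even iterates. *)
  - move=> u u1; have [t ut] := cdfR_hi (z 1%N) u1; exists t.
    by apply: le_trans ut _; apply: geF => n; exact: odd_le.
  - move=> t; rewrite (le_trans (Fle 0%N _)) ?cdfR_le1// andbT.
    by apply: geF => n; exact: cdfR_ge0.
have evcvg t : (fun n => cdfR (z n.*2) t) @ \oo --> cdfR alpha t by rewrite alphaE.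
have oddcvg t : (fun n => cdfR (z n.*2.+1) t) @ \oo --> cdfR (next alpha) t.
  rewrite nextE /=; under eq_fun do rewrite nextE.
  by apply: next_cdf_cvg => // s; exact: evcvg.
have evcvg' t : (fun n => cdfR (z n.*2.+2) t) @ \oo --> next_cdf (next alpha) t.
  rewrite /=; under eq_fun do rewrite nextE.
  by apply: next_cdf_cvg => // s; exact: oddcvg.
exists alpha, (next alpha); split.
- move=> t; rewrite -(cvg_lim _ (oddcvg t))// -(cvg_lim _ (evcvg t))//.
  apply: ler_lim; [exact: cvgP (oddcvg t)|exact: cvgP (evcvg t)|].
  by near=> n; exact: odd_ev.
- move=> t; have := evcvg t; rewrite -(cvg_shiftS (fun n => cdfR (z n.*2) t)) => h.
  rewrite -(cvg_lim _ h)// -(cvg_lim _ (evcvg' t))//.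
- exact: nextE.
move=> zeta zE t.
(* Since the map fixes [zeta] and is antitone, it turns upper bounds of [zeta] into lower bounds and
   conversely. *)
have sandwich n s : (cdfR (z n.*2.+1) s <= cdfR zeta s <= cdfR (z n.*2) s)%R.
  have fix_le x : (forall u, (cdfR zeta u <= cdfR x u)%R) ->
      forall u, (cdfR (next x) u <= cdfR zeta u)%R.
    by move=> h u; rewrite nextE (zE u) le_next_cdf.
  have fix_ge x : (forall u, (cdfR x u <= cdfR zeta u)%R) ->
      forall u, (cdfR zeta u <= cdfR (next x) u)%R.
    by move=> h u; rewrite nextE (zE u) le_next_cdf.
  suff h : forall u, (cdfR zeta u <= cdfR (z n.*2) u)%R.
    by rewrite h andbT; exact: fix_le.
  elim: n => [|n IH] u; last by rewrite doubleS; apply: (fix_ge _); apply: (fix_le _).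
  by have := z0_ge zeta u; rewrite nextE -zE.
rewrite -(cvg_lim _ (oddcvg t))// -(cvg_lim _ (evcvg t))//; apply/andP; split.
  apply: limr_le; first exact: cvgP (oddcvg t).
  by near=> n; have /andP[] := sandwich n t.
apply: limr_ge; first exact: cvgP (evcvg t).
by near=> n; have /andP[] := sandwich n t.
Unshelve. all: by end_near. Qed.

End ExtremalPair.

(** * Uniqueness *)

Section ChangeOfVariables.
Variable R : realType.
Local Notation mR := (measurableTypeR R).

Lemma ge0_integral_law d (T : measurableType d) (P : {measure set T -> \bar R})
    (X : T -> mR) (nu : probability mR R) (f : mR -> \bar R) :
  measurable_fun setT X ->
  (forall A, measurable A -> nu A = P (X @^-1` A)) ->
  measurable_fun setT f -> (forall x, 0 <= f x) ->
  \int[nu]_x f x = \int[P]_x f (X x).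
Proof.
move=> mX nuE mf f0.
rewrite -(@ge0_integral_pushforward _ _ _ _ R X mX P setT f)//.
by apply: eq_measure_integral => A mA _; exact: nuE.
Qed.

Lemma cdfR_lc (nu : probability mR R) t u : atomless nu ->
  (forall s, (s < t)%R -> (cdfR nu s <= u)%R) -> (cdfR nu t <= u)%R.
Proof.
move=> nu0 h.
have -> : cdfR nu t = fine (nu `]-oo, t[%classic).
  congr fine; rewrite -(setUitv1 true)//= measureU//.
    exact: eq_trans (congr1 _ (nu0 t)) (adde0 _).
  by rewrite -subset0 => x /= [+ xt]; rewrite xt ?in_itv/= ltxx.
suff cv : (fun n : nat => nu `]-oo, (t - n.+1%:R^-1)%R]%classic) @ \oo --> nu `]-oo, t[%classic.
  rewrite -lee_fin fineK ?fin_num_measure// -(cvg_lim _ cv)//.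
  apply: lime_le; first by apply/cvg_ex; eexists; exact: cv.
  by near=> n; rewrite -cdfRE lee_fin h// gtrBl invr_gt0.
have -> : `]-oo, t[%classic = \bigcup_n `]-oo, (t - n.+1%:R^-1)%R]%classic :> set R.
  apply/seteqP; split=> x /=; rewrite in_itv/=.
    by move=> /ltr_add_invr[k xk]; exists k => //=; rewrite in_itv/= lerBrDr ltW.
  by move=> [k _ /=]; rewrite in_itv/= => /le_lt_trans; apply; rewrite gtrBl invr_gt0.
apply: nondecreasing_cvg_mu => //; first exact: bigcup_measurable.
move=> m n mn; apply/subsetPset; apply: subset_itvl.
by rewrite bnd_simp lerD2l lerN2 lef_pV2 ?posrE// ler_nat.
Unshelve. all: by end_near. Qed.

(** Below [Q u] the distribution function stays under [u], and without atoms this bound survives at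
    [Q u] itself. *)
Lemma quantile_continuous (nu : probability mR R) (Q : mR -> mR) u :
  atomless nu ->
  (forall u t, (0 < u < 1)%R -> (Q u <= t)%R = (u <= cdfR nu t)%R) ->
  (0 < u < 1)%R -> cdfR nu (Q u) = u.
Proof.
move=> nu0 QE u01; apply/eqP; rewrite eq_le -(QE u)// lexx andbT.
apply: cdfR_lc => // s sQ; rewrite leNgt; apply/negP => /ltW.
by rewrite -QE// leNgt sQ.
Qed.

Lemma unif_atomless : atomless (unif R).
Proof.
move=> x; rewrite unifE//; apply/eqP; rewrite -measure_le0.
rewrite -(lebesgue_measure_set1 x); apply: le_measure; rewrite ?inE//.
exact: measurableI.
Qed.

End ChangeOfVariables.

Section Uniqueness.
Variables (R : realType) (omega : probability (measurableTypeR R) R).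
Variable p : probability nat R.
Hypothesis omega_atomless : atomless omega.
Local Notation mR := (measurableTypeR R).

Definition mass_sum (alpha beta : probability mR R) : \bar R :=
  \int[omega]_w \int[alpha]_z (cdfR beta (w - z))%:E.

(** For fixed [w], both inner integrals compute the mass of the half-plane [x.1 + x.2 <= w] under
    the product law, sliced along one coordinate or the other. *)
Lemma mass_sumC alpha beta : mass_sum alpha beta = mass_sum beta alpha.
Proof.
apply: eq_integral => w _.
pose D := [set x : mR * mR | (x.1 + x.2 <= w)%R].
have mD : measurable D.
  rewrite (_ : D = (fun x : mR * mR => x.1 + x.2)%R @^-1` `]-oo, w]%classic).
    rewrite -[X in measurable X]setTI.
    have ms : measurable_fun setT (fun x : mR * mR => x.1 + x.2 : mR)%R.
      exact: measurable_funD.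
    exact: ms.
  by apply/seteqP; split=> x /=; rewrite in_itv.
transitivity ((alpha \x beta) D).
  rewrite product_xsection//; apply: eq_integral => z _.
  rewrite cdfRE; congr (beta _); apply/seteqP; split=> y /=;
    rewrite /xsection/= inE /D/= in_itv/=; lra.
apply: eq_trans (product_ysection alpha beta mD) _; apply: eq_integral => z _.
rewrite cdfRE; congr (alpha _); apply/seteqP; split=> y /=;
  rewrite /ysection/= inE /D/= in_itv/=; lra.
Qed.

(** Projection onto the unit interval, where [pgf] is monotone: [pgf_above] becomes nondecreasing on
    the whole line, hence measurable. *)
Definition clip (u : R) : R := Num.max 0%R (Num.min 1%R u).

Definition pgf_above (h u : R) : R := if (h < u)%R then pgf p (clip u) else 0%R.

Lemma clip01 u : (0 <= clip u <= 1)%R.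
Proof. by rewrite /clip le_max lexx /= ge_max ler01 ge_min lexx. Qed.

Lemma clip_id u : (0 < u < 1)%R -> clip u = u.
Proof.
by move=> /andP[u0 u1]; rewrite /clip min_r ?ltW// max_r// ltW.
Qed.

Lemma le_clip : {homo clip : u v / (u <= v)%R}.
Proof.
move=> u v uv; rewrite /clip ge_max le_max lexx/= le_max.
apply/orP; right; rewrite le_min !ge_min lexx /= uv orbT//.
Qed.

Lemma pgf_above_ge0 h u : (0 <= pgf_above h u)%R.
Proof. by rewrite /pgf_above; case: ifP => // _; rewrite pgf_ge0// clip01. Qed.

Lemma pgf_above_le1 h u : (pgf_above h u <= 1)%R.
Proof. by rewrite /pgf_above; case: ifP => // _; rewrite pgf_le1// clip01. Qed.

Lemma measurable_pgf_above h : measurable_fun setT (fun u : mR => (pgf_above h u)%:E).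
Proof.
apply/measurable_EFinP.
apply: (@nondecreasing_measurable R setT) => //.
move=> u v uv; rewrite /pgf_above; case: (ltP h u) => [hu|_].
  rewrite (lt_le_trans hu uv).
  have /andP[u0 _] := clip01 u; have /andP[_ v1] := clip01 v.
  by apply: le_pgf => //; exact: le_clip.
by case: ifP => // _; rewrite pgf_ge0// clip01.
Qed.

(* With X = w - Z_alpha, the left-hand side is P(X >= Z_beta); since Z_beta is
   the maximum of 0 and N copies of X, this depends only on the law of the
   uniform variable F_X(X) and on F_X(0). *)
Lemma mass_sum_next alpha beta : cdfR beta =1 next_cdf omega p alpha ->
  mass_sum alpha beta = \int[unif R]_u (pgf_above (cdf_diff omega alpha 0) u)%:E.
Proof.
move=> betaE; have [mu [muE muF]] := exists_diff_law omega alpha.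
have mu0 : atomless mu.
  move=> t; rewrite muE//; exact: product_diff_eq0.
have [Q [mQ QE]] := exists_quantile (@cdfR_nd _ mu) (@cdfR_rc _ mu)
  (@cdfR_lo _ mu) (@cdfR_hi _ mu).
have mF : measurable_fun setT (fun t : mR => (cdfR beta t)%:E).
  by apply/measurable_EFinP; exact: cdfR_measurable.
have F0 t : 0 <= (cdfR beta t)%:E by rewrite lee_fin cdfR_ge0.
transitivity (\int[mu]_t (cdfR beta t)%:E).
  rewrite (ge0_integral_law (@measurable_diff R) muE)//.
  by rewrite fubini_tonelli1//; exact: (measurableT_comp mF (@measurable_diff R)).
have [nu nuE] := pushforward_law (unif R) mQ.
have munu A : measurable A -> mu A = nu A.
  apply: eq_cdfR => t; rewrite /cdfR nuE (quantile_law mQ QE)//.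
  by rewrite cdfR_ge0 cdfR_le1.
have muQ A : measurable A -> mu A = unif R (Q @^-1` A).
  by move=> mA; rewrite munu// nuE.
rewrite (ge0_integral_law mQ muQ)//.
apply: ge0_ae_eq_integral => //.
- exact: measurableT_comp mF mQ.
- exact: measurable_pgf_above.
- by move=> u _; rewrite lee_fin pgf_above_ge0.
set h := cdf_diff omega alpha 0%R.
(* Besides the points where [Q] has its default value, [u = h] is removed: there [Q u] may be 0 or
   negative. *)
exists (~` `]0%R, 1%R[%classic `|` [set h]); split.
- by apply: measurableU => //; exact: measurableC.
- apply/eqP; rewrite -measure_le0.
  apply: le_trans (measureU2 _ _ _) _ => //; first exact: measurableC.
  rewrite [X in X + _](_ : _ = 0); last first.
    apply: eq_trans (probability_setC (unif R) _) _ => //.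
    by rewrite unif_oo subee.
  by rewrite [X in _ + X](_ : _ = 0) ?adde0//; exact: unif_atomless.
move=> u /= uN; apply: contrapT => /not_orP[/contrapT u01 uh]; apply: uN => _.
rewrite in_itv/= in u01.
congr EFin; rewrite betaE /next_cdf -muF (quantile_continuous mu0 QE u01).
rewrite /pgf_above clip_id//.
(* The sign of [Q u] is that of [u - h]. For [u < h] this rests on left continuity at 0: a flat
   stretch of the distribution function could not reach [h] by a jump. *)
have [hu|uh'] := ltP h u.
  rewrite ifT// ltW// ltNge; apply/negP; rewrite QE// muF -/h leNgt hu//.
rewrite ifF//; apply/negbTE; rewrite -ltNge.
have {uh'} uh' : (u < h)%R by rewrite lt_neqAle uh' andbT; apply/eqP.
apply: contrapT => /negP; rewrite -leNgt => Q0.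
suff : (h <= u)%R by rewrite leNgt uh'.
rewrite /h -muF; apply: cdfR_lc => // s s0; rewrite leNgt; apply/negP => /ltW.
by rewrite -QE// leNgt (lt_le_trans s0 Q0).
Qed.

(** If [h < h'], the integrand for [h] exceeds the other by a positive constant on an interval of
    positive length inside []h, h']]. *)
Lemma pgf_above_inj h h' : (0 <= h)%R -> (h <= h')%R -> (h' <= 1)%R ->
  \int[unif R]_u (pgf_above h u)%:E = \int[unif R]_u (pgf_above h' u)%:E ->
  h = h'.
Proof.
move=> h0 hh' h'1 E; apply/eqP; rewrite eq_le hh'/= leNgt; apply/negP => lt.
(* The midpoint keeps away from 0, where [pgf] may vanish when [h = 0]; above [m] it is at least
   [pgf p m > 0]. *)
pose m := ((h + h') / 2)%R.
have hm : (h < m)%R by rewrite /m; lra.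
have mh' : (m < h')%R by rewrite /m; lra.
have m0 : (0 < m)%R := le_lt_trans h0 hm.
have m1 : (m < 1)%R := lt_le_trans mh' h'1.
pose c := pgf p m; have c0 : (0 < c)%R by apply: pgf_gt0 => //; exact: ltW.
pose I : set mR := `]m, h']%classic.
have mI : measurable I by exact: measurable_itv.
have UI : unif R I = (h' - m)%:E.
  have mh'' := ltW mh'.
  apply: (@unif_itv _ _ _ false false) => //.
  apply/seteqP; split=> u /=; rewrite !in_itv/=; first by case.
  by move=> /andP[mu uh']; rewrite /I /= in_itv/= mu uh' (le_trans uh' h'1) (ltW (lt_trans m0 mu)).
have : \int[unif R]_u (pgf_above h' u)%:E + c%:E * unif R I <=
    \int[unif R]_u (pgf_above h u)%:E.
  have -> : c%:E * unif R I = \int[unif R]_u (c * \1_I u)%:E.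
    under eq_integral do rewrite EFinM.
    rewrite ge0_integralZl//; last 2 first.
    - by apply/measurable_EFinP; exact: measurable_indic.
    - by rewrite lee_fin ltW.
    by rewrite integral_indic// setIT.
  rewrite -ge0_integralD//; last 4 first.
  - by move=> u _; rewrite lee_fin pgf_above_ge0.
  - exact: measurable_pgf_above.
  - by move=> u _; rewrite lee_fin mulr_ge0// ltW.
  - by apply/measurable_EFinP; apply: measurable_funM => //; exact: measurable_indic.
  apply: (@ge0_le_integral _ _ _ (unif R) setT measurableT) => //.
  - by move=> u _; rewrite -EFinD lee_fin addr_ge0 ?pgf_above_ge0// mulr_ge0// ltW.
  - apply: emeasurable_funD; first exact: measurable_pgf_above.
    by apply/measurable_EFinP; apply: measurable_funM => //; exact: measurable_indic.
  - exact: measurable_pgf_above.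
  move=> u _; rewrite -EFinD lee_fin indicE /pgf_above.
  have [uI|uI] := boolP (u \in I).
    have : I u := set_mem uI; rewrite /I /= in_itv/= => /andP[mu uh'].
    rewrite mulr1 ifF ?add0r; last by apply/negbTE; rewrite -leNgt.
    rewrite (lt_trans hm mu) /c -(@clip_id m) ?m0//.
    have /andP[? _] := clip01 m; have /andP[_ ?] := clip01 u.
    by apply: le_pgf => //; apply: le_clip; exact: ltW.
  rewrite mulr0 addr0; case: ifP => [h'u|_]; first by rewrite (le_lt_trans hh' h'u).
  by case: ifP => // _; rewrite pgf_ge0// clip01.
rewrite E UI leNgt => /negP; apply; rewrite lteDl; last first.
  rewrite ge0_fin_numE; last by apply: integral_ge0 => u _; rewrite lee_fin pgf_above_ge0.
  apply: (@le_lt_trans _ _ (\int[unif R]_u cst 1 u)).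
    apply: (@ge0_le_integral _ _ _ (unif R) setT measurableT) => //.
    - by move=> u _; rewrite lee_fin pgf_above_ge0.
    - exact: measurable_pgf_above.
    - by move=> u _; rewrite lee_fin pgf_above_le1.
  by rewrite integral_cst// mul1e (le_lt_trans (probability_le1 _ _)) ?ltry.
by rewrite -EFinM lte_fin mulr_gt0// subr_gt0.
Qed.


(** * The set of agreement of the extremal pair *)

Variables alpha beta : probability mR R.
Hypothesis beta_le : forall t, (cdfR beta t <= cdfR alpha t)%R.
Hypothesis alphaE : cdfR alpha =1 next_cdf omega p beta.
Hypothesis betaE : cdfR beta =1 next_cdf omega p alpha.

Let H (zeta : probability mR R) := cdf_diff omega zeta.

Let H_le t : (H alpha t <= H beta t)%R.
Proof. by rewrite /H !cdf_diffE// lerD2l lerN2 le_surv. Qed.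

Let H_eq0 : H alpha 0%R = H beta 0%R.
Proof.
have /andP[h0 _] := cdf_diff01 omega alpha 0%R.
have /andP[_ h1] := cdf_diff01 omega beta 0%R.
apply: (pgf_above_inj h0 _ h1); first exact: H_le.
by rewrite -(mass_sum_next betaE) -(mass_sum_next alphaE) mass_sumC.
Qed.

Let E (t : R) := H alpha t = H beta t.

(** For [t] in [E], the nonnegative function [g] has integral 0 under [omega]. It therefore vanishes
    almost everywhere, hence somewhere in each measurable set of positive mass. *)
Let generic (t : R) : E t -> forall A : set mR, measurable A -> 0 < omega A ->
  exists2 w, A w & cdfR beta (w - t) = cdfR alpha (w - t)%R.
Proof.
move=> Et A mA A0; apply: contrapT => noex.
have eqS : \int[omega]_w (cdfR beta (w - t))%:E = \int[omega]_w (cdfR alpha (w - t))%:E.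
  have := Et; rewrite /E /H !cdf_diffE// => /addrI/oppr_inj h.
  by rewrite -!survE h.
pose g w := (cdfR alpha (w - t) - cdfR beta (w - t))%:E.
have g0 w : 0 <= g w by rewrite lee_fin subr_ge0.
have mg : measurable_fun setT (g : mR -> \bar R).
  apply/measurable_EFinP; apply: measurable_funB; apply/measurable_EFinP.
    exact: measurable_cdf_shift.
  exact: measurable_cdf_shift.
have : \int[omega]_w g w = 0.
  have : \int[omega]_w g w + \int[omega]_w (cdfR beta (w - t))%:E =
      \int[omega]_w (cdfR alpha (w - t))%:E.
    rewrite -ge0_integralD//.
    - by apply: eq_integral => w _; rewrite -EFinD subrK.
    - by move=> w _; rewrite lee_fin cdfR_ge0.
    - exact: measurable_cdf_shift.
  rewrite eqS -survE => /(congr1 (fun x => x - (surv omega alpha t)%:E)).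
  by rewrite addeK// subee.
under eq_integral do rewrite -(gee0_abs (g0 _)).
move=> /(ae_eq_integral_abs omega measurableT mg)[N [mN N0 sN]].
move: A0; rewrite ltNge => /negP; apply; rewrite -N0; apply: le_measure; rewrite ?inE//.
move=> w Aw; apply: sN => /= /(_ I) [] /eqP; rewrite subr_eq0 => /eqP h.
by apply: noex; exists w.
Qed.

(** At the nonnegative point [w - t] both distribution functions are values of [pgf], which is
    injective on the unit interval when N is not almost surely 0. *)
Let E_step (t w : R) : p [set 0%N] != 1 -> E t -> (t <= w)%R ->
  cdfR beta (w - t)%R = cdfR alpha (w - t)%R -> E (w - t)%R.
Proof.
move=> p0 Et tw; rewrite alphaE betaE /next_cdf subr_ge0 tw => h.
have /andP[h0 _] := cdf_diff01 omega alpha (w - t)%R.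
have /andP[_ h1] := cdf_diff01 omega beta (w - t)%R.
apply/eqP; rewrite eq_le H_le/= leNgt; apply/negP => lt.
by have := lt_pgf p0 h0 lt h1; rewrite h ltxx.
Qed.

(** For [s < sup A] pick [e] in [A] above [s]: H_beta(s) <= H_beta(e) = H_alpha(e) <= H_alpha(sup
    A). Left continuity of H_beta lets [s] reach the supremum. *)
Let E_sup (A : set R) : has_sup A -> (forall t, A t -> E t) -> E (sup A).
Proof.
move=> supA AE; apply/eqP; rewrite eq_le H_le/=.
have [mu [muE muF]] := exists_diff_law omega beta.
have mu0 : atomless mu by move=> t; rewrite muE//; exact: product_diff_eq0.
have [nu [_ nuF]] := exists_diff_law omega alpha.
rewrite -[H beta _]muF; apply: cdfR_lc => // s sA.
have [] := sup_adherent (eps := sup A - s) _ supA; first by rewrite subr_gt0.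
move=> e Ae; rewrite subKr => se.
apply: (@le_trans _ _ (cdfR mu e)); first by rewrite cdfR_nd// ltW.
rewrite muF -[cdf_diff _ _ _]/(H beta e) -(AE e Ae) /H -!nuF cdfR_nd//.
by apply: sup_upper_bound.
Qed.

(** Z_alpha is nonnegative, so w - Z_alpha >= x forces w >= x. *)
Let surv_le (x : R) : (surv omega alpha x <= 1 - cdfR omega x)%R.
Proof.
rewrite -lee_fin survE -cdfR_ccdf.
have -> : omega `]x, +oo[%classic = omega `[x, +oo[%classic.
  rewrite -(setU1itv false)//= measureU//; last first.
    by rewrite -subset0 => y /= [->]; rewrite in_itv/= ltxx.
  exact/esym/(eq_trans (congr1 (fun y => y + _) (omega_atomless x)))/add0e.
rewrite -[X in omega X]setIT -integral_indic//.
apply: (@ge0_le_integral _ _ _ omega setT measurableT) => //.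
- by move=> w _; rewrite lee_fin cdfR_ge0.
- exact: measurable_cdf_shift.
- exact/measurable_EFinP.
move=> w _; rewrite lee_fin indicE; case: (boolP (w \in _)) => wx.
  exact: cdfR_le1.
rewrite alphaE /next_cdf subr_ge0 ifF//; apply/negbTE; apply: contra wx => xw.
by rewrite inE/= in_itv/= xw.
Qed.

Let omega_oc (a b : R) : (cdfR omega a < cdfR omega b)%R -> 0 < omega `]a, b]%classic.
Proof.
move=> ab.
have leab : (a <= b)%R.
  by rewrite leNgt; apply/negP => /ltW/(@cdfR_nd _ omega); rewrite leNgt ab.
have : omega `]-oo, b]%classic = omega `]-oo, a]%classic + omega `]a, b]%classic.
  rewrite -measureU//.
    congr (omega _); apply/seteqP; split=> y /=; rewrite !in_itv/=.
      by move=> yb; case: (leP y a) => ya; [left|right].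
    by move=> [ya|/andP[]//]; exact: le_trans ya leab.
  by rewrite -subset0 => x /= []; rewrite !in_itv/= => /le_lt_trans h /andP[/h]; rewrite ltxx.
rewrite -!cdfRE => h; rewrite lt_def measure_ge0 andbT; apply/eqP => h0.
by move: h; rewrite h0 adde0 => -[h]; rewrite h ltxx in ab.
Qed.

Let E_all (x : R) : p [set 0%N] != 1 -> (0 <= x)%R -> E x.
Proof.
move=> p0 x0; apply: contrapT => nEx.
pose A := [set e : R | (0 <= e <= x)%R /\ E e].
have supA : has_sup A.
  split; first by exists 0%R; split; [rewrite lexx x0|exact: H_eq0].
  by exists x => e [/andP[]].
pose a0 := sup A.
have Ea0 : E a0 by apply: E_sup => // t [].
have a00 : (0 <= a0)%R.
  by apply: sup_upper_bound => //; split; [rewrite lexx x0|exact: H_eq0].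
have a0x : (a0 < x)%R.
  rewrite lt_neqAle; apply/andP; split; first by apply/eqP => h; apply: nEx; rewrite -h.
  by apply: ge_sup; [case: supA|move=> e [/andP[]]].
pose F := cdfR omega.
(* Otherwise [omega] has no mass beyond [x], both survival probabilities vanish there, and [x] lies
   in [E]. *)
have Fx1 : (F x < 1)%R.
  rewrite ltNge; apply/negP => Fx; apply: nEx.
  have sa := surv_le x; have sb : (surv omega beta x <= surv omega alpha x)%R by exact: le_surv.
  have /andP[sb0 _] := surv01 omega_atomless beta x.
  have sa0 : surv omega alpha x = 0%R.
    by apply/eqP; rewrite eq_le (le_trans sb0 sb) andbT (le_trans sa)// subr_le0.
  have sb0' : surv omega beta x = 0%R.
    by apply/eqP; rewrite eq_le sb0 andbT -sa0.
  by rewrite /E /H !cdf_diffE// sa0 sb0'.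
(* [m] is the right end of the plateau of [F] at level [F x]: every interval just to the right of
   [m] is charged by [omega], and [m >= x]. *)
pose B := [set t | (F t <= F x)%R].
have supB : has_sup B.
  split; first by exists x; exact: lexx (F x).
  have [t ut] := @cdfR_hi _ omega ((F x + 1) / 2)%R ltac:(lra).
  exists t => s /= Fs; rewrite leNgt; apply/negP => /ltW/(@cdfR_nd _ omega).
  by move=> ts; have := le_trans (le_trans ut ts) Fs; lra.
pose m := sup B.
have xm : (x <= m)%R by apply: sup_upper_bound => //; exact: lexx (F x).
have Fm : (F m <= F x)%R.
  apply: cdfR_lc => // s sm.
  have [] := sup_adherent (eps := m - s) _ supB; first by rewrite subr_gt0.
  move=> e Be; rewrite subKr => /ltW/(@cdfR_nd _ omega) h; exact: le_trans h Be.
have Fgt s : (m < s)%R -> (F x < F s)%R.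
  by move=> ms; rewrite ltNge; apply/negP => Fs; have := sup_upper_bound supB Fs; rewrite leNgt ms.
(* Half of the gap: with [w1] and [w2] in []m, s2]], the translation by [w2 - w1] moves [a0] by less
   than [x - a0]. *)
pose s2 := (m + (x - a0) / 2)%R.
have ms2 : (m < s2)%R by rewrite /s2; lra.
(* Right continuity at [m] yields a cut [s1] with mass on both sides, so that [w1 <= s1 < w2]. *)
have [s1 [ms1 s12]] : exists s1, (m < s1)%R /\ (F s1 < F s2)%R.
  apply: contrapT => h.
  have : (F s2 <= F m)%R.
    apply: cdfR_rc => s ms; rewrite leNgt; apply/negP => Fs; apply: h; by exists s.
  by rewrite leNgt (le_lt_trans Fm (Fgt _ ms2)).
have s1s2 : (s1 < s2)%R.
  by rewrite ltNge; apply/negP => /(@cdfR_nd _ omega); rewrite leNgt s12.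
have [w1] := generic Ea0 (measurable_itv `]m, s1]) (omega_oc (le_lt_trans Fm (Fgt _ ms1))).
rewrite /= in_itv/= => /andP[mw1 w1s1] h1.
have Ew1 : E (w1 - a0)%R by apply: E_step => //; lra.
have [w2] := generic Ew1 (measurable_itv `]s1, s2]) (omega_oc s12).
rewrite /= in_itv/= => /andP[s1w2 w2s2] h2.
have Ew2 : E (w2 - (w1 - a0))%R by apply: E_step => //; lra.
(* The new point [a0 + (w2 - w1)] belongs to [A] and exceeds its supremum. *)
have : (w2 - (w1 - a0) <= a0)%R.
  by apply: sup_upper_bound => //; split=> //; rewrite /s2 in w2s2; lra.
lra.
Qed.

Lemma extremal_pair_eq : cdfR alpha =1 cdfR beta.
Proof.
(* When N = 0 almost surely, [pgf] is constantly 1 on the unit interval and both laws are the unit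
   mass at 0. *)
move=> t; have [p0|p0] := eqVneq (p [set 0%N]) 1.
  have pgfE1 (x : R) : (0 <= x <= 1)%R -> pgf p x = 1%R.
    move=> x01; apply/eqP; rewrite eq_le pgf_le1//= -lee_fin.
    by rewrite -p0 pgf_ge_atom0.
  by rewrite alphaE betaE /next_cdf !pgfE1// cdf_diff01.
rewrite alphaE betaE /next_cdf; have [t0|//] := boolP (0 <= t)%R.
by congr pgf; exact/esym/E_all.
Qed.

End Uniqueness.

Theorem theorem3 (R : realType)
    (omega : probability (measurableTypeR R) R)
    (omega_atomless : atomless omega)
    (omega_not_singular : not_singular_near_sup omega)
    (pihat : probability nat R)
    (pihat_finite_mean : (\int[pihat]_n (n%:R)%:E < +oo)%E) :
  exists zeta : probability (measurableTypeR R) R,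
    rde_solution omega pihat zeta /\
    forall zeta' : probability (measurableTypeR R) R,
      rde_solution omega pihat zeta' -> same_law zeta' zeta.
Proof.
have [alpha [beta [ba alphaE betaE between]]] :=
  exists_extremal_pair pihat omega_atomless.
have ab := extremal_pair_eq omega_atomless ba alphaE betaE.
exists alpha; split.
  by apply/rde_solutionP => t; rewrite alphaE; apply: eq_next_cdf => // s; rewrite ab.
move=> zeta' /rde_solutionP/between zeta'E; apply: eq_cdfR => t.
by have := zeta'E t; rewrite -ab => /le_anti ->.
Qed.
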